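(* Let $R$ be a commutative ring and $B$ an $R$-bialgebra. There are bijections between: (1) cobraidings (coquasitriangular structures) on the bialgebra $B$; (2) braidings on the skew monoidal category $R\text{-}\mathbf{Mod}[B]$; (3) braidings (in the usual sense) on the monoidal category $R\text{-}\mathbf{Mod}^B$ of $B$-comodules.
   Context: Tensor products are over $R$; $\mu,\eta,\delta,\epsilon$ denote the structure maps of $B$, with $\delta(b)=\sum b_1\otimes b_2$. A skew monoidal category is a category with a functor $(X,Y)\mapsto XY$, an object $I$ and natural transformations (not necessarily invertible) $a_{X,Y,Z}\colon (XY)Z\to X(YZ)$, $\ell_X\colon IX\to X$, $r_X\colon X\to XI$ such that $a_{A,B,CD}\,a_{AB,C,D}=(1_A a_{B,C,D})\,a_{A,BC,D}\,(a_{A,B,C}1_D)$; $\ell_{AB}\,a_{I,A,B}=\ell_A1_B$; $(1_A\ell_B)\,a_{A,I,B}\,(r_A1_B)=1_{AB}$; $a_{A,B,I}\,r_{AB}=1_Ar_B$; $\ell_I r_I=1_I$. The skew monoidal category $R\text{-}\mathbf{Mod}[B]$ is the category of $R$-modules with product $X\star Y=X\otimes B\otimes Y$, unit $R$, associativity $(X\star Y)\star Z\to X\star(Y\star Z)$ given by $x\otimes b\otimes y\otimes c\otimes z\mapsto \sum x\otimes bc_1\otimes y\otimes c_2\otimes z$, left unit map $R\otimes B\otimes X\to X$, $1\otimes b\otimes x\mapsto\epsilon(b)x$, and right unit map $X\to X\otimes B\otimes R$, $x\mapsto x\otimes 1_B\otimes 1$. A braiding on a skew monoidal category is a natural isomorphism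 $s_{X,A,B}\colon (XA)B\to (XB)A$ such that for all objects: (B1) $s_{XC,A,B}(s_{X,A,C}1_B)s_{XA,B,C}=(s_{X,B,C}1_A)s_{XB,A,C}(s_{X,A,B}1_C)$; (B2) $s_{X,A,BC}\,a_{XA,B,C}=(a_{X,B,C}1_A)s_{XB,A,C}(s_{X,A,B}1_C)$; (B3) $s_{X,AB,C}(a_{X,A,B}1_C)=a_{XC,A,B}(s_{X,A,C}1_B)s_{XA,B,C}$; (B4) $(1_Xs_{A,B,C})\,a_{X,AB,C}(a_{X,A,B}1_C)=a_{X,AC,B}(a_{X,A,C}1_B)s_{XA,B,C}$. $R\text{-}\mathbf{Mod}^B$ is the category of coalgebras for the comonad $B\otimes-$, i.e. left $B$-comodules, with tensor product $\otimes_R$, coaction $x\otimes y\mapsto \sum x_{(-1)}y_{(-1)}\otimes x_{(0)}\otimes y_{(0)}$. A cobraiding (coquasitriangular structure) on $B$ is a convolution-invertible $R$-linear map $\sigma\colon B\otimes B\to R$ such that for all $a,b,c\in B$: $\sum\sigma(a_1,b_1)\,b_2a_2=\sum a_1b_1\,\sigma(a_2,b_2)$; $\sigma(ab,c)=\sum\sigma(a,c_2)\sigma(b,c_1)$; $\sigma(a,bc)=\sum\sigma(a_1,b)\sigma(a_2,c)$. (This is the convention suited to left comodules; other common conventions differ by interchanging the arguments of $\sigma$.) *)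

(* Defs.v *)
From HB Require Import structures.
From mathcomp Require Import all_boot all_algebra.
From mathcomp Require Import boolp.

Set Implicit Arguments.
Unset Strict Implicit.
Unset Printing Implicit Defensive.

Import GRing.Theory.
Local Open Scope ring_scope.
Local Open Scope quotient_scope.

Section LinearMaps.
Variable R : comPzRingType.
Implicit Types M N P : lmodType R.

Definition is_bilinear M N P (f : M -> N -> P) : Prop :=
  (forall n, linear (f^~ n)) /\ (forall m, linear (f m)).

Definition mk_linear M N (f : M -> N) (lf : linear f) : {linear M -> N} :=
  HB.pack_for {linear M -> N} f (GRing.isLinear.Build R M N *:%R f lf).

Lemma mk_linearE M N (f : M -> N) (lf : linear f) : mk_linear lf =1 f.
Proof. by []. Qed.

Lemma linear_ext M N (f g : {linear M -> N}) : f =1 g -> f = g.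
Proof.
move=> fg; have /funext {fg} : (f : M -> N) =1 g by [].
case: f g => [f [[f1] [f2]]] [g [[g1] [g2]]] /= fg; subst g.
by rewrite (Prop_irrelevance f1 g1) (Prop_irrelevance f2 g2).
Qed.

Lemma linear_funD M N (f : M -> N) : linear f -> {morph f : x y / x + y}.
Proof. by move=> lf x y; apply: (linearD (mk_linear lf)). Qed.

Lemma linear_funZ M N (f : M -> N) : linear f -> forall k x, f (k *: x) = k *: f x.
Proof. by move=> lf k x; apply: (linearZ_LR (mk_linear lf)). Qed.

Lemma linear_fun0 M N (f : M -> N) : linear f -> f 0 = 0.
Proof. by move=> lf; apply: (linear0 (mk_linear lf)). Qed.

Lemma linear_fun_sum M N (f : M -> N) : linear f -> forall I (r : seq I) F,
  f (\sum_(i <- r) F i) = \sum_(i <- r) f (F i).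
Proof. by move=> lf I r F; apply: (linear_sum (mk_linear lf)). Qed.

End LinearMaps.

(* An element of M ⊗ N is a class of formal sums
   \sum_i m_i ⊗ₜ n_i, two such sums being identified exactly when every bilinear
   map out of M x N takes the same value on both; [tlift] and [tens_linear_eq]
   are the universal property. *)

Section Tensor.
Variable R : comPzRingType.
Section Construction.
Variables M N : lmodType R.

Definition formal_sum (P : lmodType R) (f : M -> N -> P) (s : seq (M * N)) : P :=
  \sum_(p <- s) f p.1 p.2.

Definition tens_eqv (s t : seq (M * N)) : bool :=
  `[< forall (P : lmodType R) (f : M -> N -> P),
        is_bilinear f -> formal_sum f s = formal_sum f t >].

Lemma tens_eqv_refl : reflexive tens_eqv.
Proof. by move=> s; apply/asboolP. Qed.

Lemma tens_eqv_sym : symmetric tens_eqv.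
Proof. by move=> s t; apply/asboolP/asboolP => H P f bf; rewrite H. Qed.

Lemma tens_eqv_trans : transitive tens_eqv.
Proof.
move=> t s u /asboolP st /asboolP tu; apply/asboolP => P f bf.
by rewrite st // tu.
Qed.

Definition tens_equiv : equiv_rel (seq (M * N)) :=
  EquivRel tens_eqv tens_eqv_refl tens_eqv_sym tens_eqv_trans.

Definition tens : Type := {eq_quot tens_equiv}.
HB.instance Definition _ := Choice.on tens.
HB.instance Definition _ := EqQuotient.on tens.

(* [tsum f t] is the sum of f m n over a chosen formal sum representing t.  It is
   independent of that choice, and linear in t, when f is bilinear; this covers
   every use below, where it encodes Sweedler notation. *)
Definition tsum (P : lmodType R) (f : M -> N -> P) (t : tens) : P :=
  formal_sum f (repr t).

Lemma formal_sum_repr (P : lmodType R) (f : M -> N -> P) (s : seq (M * N)) :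
  is_bilinear f -> tsum f (\pi_tens s) = formal_sum f s.
Proof.
move=> bf; have /eqmodP/asboolP := reprK (\pi_tens s).
by move=> H; rewrite /tsum H.
Qed.

Lemma tens_eqP (s t : tens) :
  (forall (P : lmodType R) (f : M -> N -> P), is_bilinear f -> tsum f s = tsum f t) ->
  s = t.
Proof.
by move=> H; rewrite -[s]reprK -[t]reprK; apply/eqmodP/asboolP.
Qed.

Definition tens_zero : tens := \pi_tens [::].
Definition tens_add (s t : tens) : tens := \pi_tens (repr s ++ repr t).
Definition tens_scale (k : R) (s : tens) : tens :=
  \pi_tens [seq (k *: p.1, p.2) | p <- repr s].
Definition tens_opp (s : tens) : tens := tens_scale (-1) s.

Section Tsum.
Variables (P : lmodType R) (f : M -> N -> P).
Hypothesis bf : is_bilinear f.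

Lemma tsum_zero : tsum f tens_zero = 0.
Proof. by rewrite formal_sum_repr // /formal_sum big_nil. Qed.

Lemma tsum_add s t : tsum f (tens_add s t) = tsum f s + tsum f t.
Proof. by rewrite formal_sum_repr // /formal_sum big_cat. Qed.

Lemma tsum_scale k s : tsum f (tens_scale k s) = k *: tsum f s.
Proof.
rewrite formal_sum_repr // /tsum /formal_sum big_map scaler_sumr.
by apply: eq_bigr => p _; rewrite (linear_funZ (bf.1 _)).
Qed.

End Tsum.

Lemma tens_addA : associative tens_add.
Proof. by move=> s t u; apply: tens_eqP => P f bf; rewrite !tsum_add // addrA. Qed.
Lemma tens_addC : commutative tens_add.
Proof. by move=> s t; apply: tens_eqP => P f bf; rewrite !tsum_add // addrC. Qed.
Lemma tens_add0 : left_id tens_zero tens_add.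
Proof. by move=> s; apply: tens_eqP => P f bf; rewrite tsum_add // tsum_zero // add0r. Qed.
Lemma tens_addN : left_inverse tens_zero tens_opp tens_add.
Proof.
move=> s; apply: tens_eqP => P f bf.
by rewrite tsum_add // tsum_scale // tsum_zero // scaleN1r addNr.
Qed.

HB.instance Definition _ :=
  GRing.isZmodule.Build tens tens_addA tens_addC tens_add0 tens_addN.

Lemma tens_scaleA (a b : R) (v : tens) :
  tens_scale a (tens_scale b v) = tens_scale (a * b) v.
Proof. by apply: tens_eqP => P f bf; rewrite !tsum_scale // scalerA. Qed.
Lemma tens_scale1 : left_id 1 tens_scale.
Proof. by move=> s; apply: tens_eqP => P f bf; rewrite tsum_scale // scale1r. Qed.
Lemma tens_scaleDr : right_distributive tens_scale +%R.
Proof.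
move=> k s t; apply: tens_eqP => P f bf.
by rewrite tsum_scale // !tsum_add // scalerDr !tsum_scale.
Qed.
Lemma tens_scaleDl (v : tens) : {morph tens_scale^~ v : a b / a + b}.
Proof.
move=> a b; apply: tens_eqP => P f bf.
by rewrite tsum_scale // !tsum_add // scalerDl !tsum_scale.
Qed.

HB.instance Definition _ := GRing.Zmodule_isLmodule.Build R tens
  tens_scaleA tens_scale1 tens_scaleDr tens_scaleDl.

Definition tens_mk (m : M) (n : N) : tens := \pi_tens [:: (m, n)].

End Construction.
End Tensor.

Arguments tens_mk {R M N} m n.
Notation "M ⊗ N" := (tens M N) (at level 40, left associativity) : type_scope.
Notation "M ⊗ N" := (tens M N) (at level 40, left associativity) : ring_scope.
Notation "m ⊗ₜ n" := (tens_mk m n) (at level 40, left associativity) : ring_scope.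

Notation "\sw_ ( x , y <- t ) F" := (tsum (fun x y => F) t)
  (at level 41, x name, y name, t at level 200, F at level 41,
   format "'[' \sw_ ( x ,  y  <-  t ) '/  '  F ']'") : ring_scope.

Section TensorTheory.
Variable R : comPzRingType.
Implicit Types M N P Q : lmodType R.

Lemma tsum_linear M N P (f : M -> N -> P) : is_bilinear f -> linear (tsum f).
Proof.
by move=> bf k s t; rewrite [LHS]tsum_add // [X in X + _]tsum_scale.
Qed.

Definition tlift M N P (f : M -> N -> P) (bf : is_bilinear f) :
  {linear M ⊗ N -> P} := mk_linear (tsum_linear bf).

Lemma tsumE M N P (f : M -> N -> P) (m : M) (n : N) :
  is_bilinear f -> tsum f (m ⊗ₜ n) = f m n.
Proof. by move=> bf; rewrite formal_sum_repr // /formal_sum big_seq1. Qed.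

Lemma tens_mk_bilinear M N : is_bilinear (@tens_mk R M N).
Proof.
split=> [n k m m' | m k n n']; apply: tens_eqP => P f bf.
  by rewrite (tsum_linear bf) !tsumE // (bf.1 n).
by rewrite (tsum_linear bf) !tsumE // (bf.2 m).
Qed.

Lemma tsum_mk M N (t : M ⊗ N) : \sw_(m, n <- t) m ⊗ₜ n = t.
Proof.
apply: tens_eqP => P f bf.
rewrite {2 3}/tsum /formal_sum (linear_fun_sum (tsum_linear bf)).
by apply: eq_bigr => p _; rewrite tsumE.
Qed.

Lemma tens_linear_eq M N P (f g : M ⊗ N -> P) : linear f -> linear g ->
  (forall m n, f (m ⊗ₜ n) = g (m ⊗ₜ n)) -> f =1 g.
Proof.
move=> lf lg fg t; rewrite -[t]tsum_mk /tsum /formal_sum !linear_fun_sum //.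
by apply: eq_bigr => p _.
Qed.

End TensorTheory.

Section SumTheory.
Variable R : comPzRingType.
Implicit Types L M N P Q : lmodType R.

Lemma lin_id M : linear (fun x : M => x).
Proof. by []. Qed.

Lemma lin_comp M N P (phi : {linear N -> P}) (g : M -> N) :
  linear g -> linear (fun x => phi (g x)).
Proof. by move=> lg k x y; rewrite lg linearP. Qed.

Lemma lin_mkl L M N (n : N) (g : L -> M) : linear g -> linear (fun x => g x ⊗ₜ n).
Proof. by move=> lg k x y; rewrite lg (tens_mk_bilinear M N).1. Qed.

Lemma lin_mkr L M N (m : M) (g : L -> N) : linear g -> linear (fun x => m ⊗ₜ g x).
Proof. by move=> lg k x y; rewrite lg (tens_mk_bilinear M N).2. Qed.

Lemma lin_scaler M N (k : R) (g : M -> N) : linear g -> linear (fun x => k *: g x).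
Proof. by move=> lg a x y; rewrite lg scalerDr !scalerA mulrC. Qed.

Lemma lin_form M N (phi : {scalar N}) (g : M -> N) :
  linear g -> linear (fun x => phi (g x) : R^o).
Proof. by move=> lg k x y; rewrite lg; apply: (linearP phi). Qed.

Lemma lin_scalel M N (v : N) (g : M -> R) :
  linear (g : M -> R^o) -> linear (fun x => g x *: v).
Proof. by move=> lg a x y; rewrite (lg a) scalerDl -scalerA. Qed.

Lemma lin_mull M (k : R) (g : M -> R) :
  linear (g : M -> R^o) -> linear (fun x => (g x * k : R) : R^o).
Proof. by move=> lg a x y; rewrite (lg a) mulrDl -mulrA. Qed.

Lemma lin_mulr M (k : R) (g : M -> R) :
  linear (g : M -> R^o) -> linear (fun x => (k * g x : R) : R^o).
Proof. by move=> lg a x y; rewrite (lg a) mulrDr mulrCA. Qed.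

Lemma lin_tsum_fun L M N P (F : L -> M -> N -> P) (t : M ⊗ N) :
  (forall m n, linear (fun x => F x m n)) ->
  linear (fun x => tsum (fun m n => F x m n) t).
Proof.
move=> lF k x y; rewrite /tsum /formal_sum scaler_sumr -big_split /=.
by apply: eq_bigr => p _; rewrite lF.
Qed.

Lemma lin_tsum_arg L M N P (f : M -> N -> P) (g : L -> M ⊗ N) :
  is_bilinear f -> linear g -> linear (fun x => tsum f (g x)).
Proof. by move=> bf lg k x y; rewrite lg (tsum_linear bf). Qed.

Lemma eq_tsum M N P (f g : M -> N -> P) (t : M ⊗ N) :
  (forall m n, f m n = g m n) -> tsum f t = tsum g t.
Proof. by move=> fg; rewrite /tsum /formal_sum; apply: eq_bigr. Qed.

Lemma tsum_exchange L M N P Q (F : L -> M -> N -> P -> Q) (s : L ⊗ M) (t : N ⊗ P) :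
  \sw_(l, m <- s) \sw_(n, p <- t) F l m n p =
  \sw_(n, p <- t) \sw_(l, m <- s) F l m n p.
Proof. exact: exchange_big. Qed.

Lemma tsum_out M N P Q (phi : P -> Q) (f : M -> N -> P) (t : M ⊗ N) :
  linear phi -> phi (tsum f t) = \sw_(m, n <- t) phi (f m n).
Proof. by move=> lphi; apply: linear_fun_sum. Qed.

End SumTheory.

Ltac lin_step :=
  cbv beta;
  match goal with
  | |- @is_bilinear _ _ _ _ _ => split=> ?
  | |- @GRing.linear_for _ _ _ _ (fun x => x) => exact: lin_id
  | |- @GRing.linear_for _ _ _ _ (fun x => tens_mk (@?g x) ?n) =>
      refine (@lin_mkl _ _ _ _ n g _)
  | |- @GRing.linear_for _ _ _ _ (fun x => tens_mk ?m (@?g x)) =>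
      refine (@lin_mkr _ _ _ _ m g _)
  | |- @GRing.linear_for _ _ _ _ (fun x => tsum (@?F x) ?t) =>
      refine (@lin_tsum_fun _ _ _ _ _ F t _) => ? ?
  | |- @GRing.linear_for _ _ _ _ (fun x => tsum ?f (@?g x)) =>
      refine (@lin_tsum_arg _ _ _ _ _ f g _ _)
  | |- @GRing.linear_for _ _ _ _ (fun x => GRing.scale ?k (@?g x)) =>
      apply: (@lin_scaler _ _ _ _ g)
  | |- @GRing.linear_for _ _ _ _ (fun x => GRing.scale (@?g x) ?v) =>
      apply: (@lin_scalel _ _ _ _ g)
  | |- @GRing.linear_for _ _ _ _ (fun x => GRing.mul (@?g x) ?k) =>
      apply: (@lin_mull _ _ _ g)
  | |- @GRing.linear_for _ _ _ _ (fun x => GRing.mul ?k (@?g x)) =>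
      apply: (@lin_mulr _ _ _ g)
  | |- @GRing.linear_for _ _ _ _ (fun x => GRing.Linear.sort ?phi (@?g x)) =>
      first [ refine (@lin_comp _ _ _ _ phi g _) | refine (@lin_form _ _ _ phi g _) ]
  | H : @is_bilinear _ _ _ _ _ |- @GRing.linear_for _ _ _ _ _ =>
      first [exact: (H.1 _) | exact: (H.2 _)]
  | H : forall _ _, @GRing.linear_for _ _ _ _ _ |- @GRing.linear_for _ _ _ _ _ =>
      exact: (H _ _)
  | |- @GRing.linear_for _ _ _ _ (tsum _) => apply: tsum_linear
  | |- @GRing.linear_for _ _ _ _ (tens_mk _) => exact: (tens_mk_bilinear _ _).2
  | |- @GRing.linear_for _ _ _ _ _ => first [assumption | exact: linearP]
  end.
Ltac lin := repeat lin_step.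

Section TensorMap.
Variable R : comPzRingType.

Lemma tmap_linear (M M' N N' : lmodType R) (f : {linear M -> M'}) (g : {linear N -> N'}) :
  linear (fun t : M ⊗ N => \sw_(m, n <- t) f m ⊗ₜ g n).
Proof. by lin. Qed.

Definition tmap (M M' N N' : lmodType R) (f : {linear M -> M'}) (g : {linear N -> N'}) :
  {linear M ⊗ N -> M' ⊗ N'} := mk_linear (tmap_linear f g).

Definition lin_idm (M : lmodType R) : {linear M -> M} := mk_linear (@lin_id R M).

Definition lin_compm (M N P : lmodType R) (g : {linear N -> P}) (f : {linear M -> N}) :
  {linear M -> P} := mk_linear (lin_comp g (linearP f)).

Lemma lin_idmE (M : lmodType R) (x : M) : lin_idm M x = x.
Proof. by []. Qed.

Lemma lin_compmE (M N P : lmodType R) (g : {linear N -> P}) (f : {linear M -> N}) x :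
  lin_compm g f x = g (f x).
Proof. by []. Qed.

Lemma linZ (M N : lmodType R) (f : {linear M -> N}) k x : f (k *: x) = k *: f x.
Proof. exact: linearZ_LR. Qed.

Lemma tmapE (M M' N N' : lmodType R) (f : {linear M -> M'}) (g : {linear N -> N'}) m n :
  tmap f g (m ⊗ₜ n) = f m ⊗ₜ g n.
Proof. by rewrite /= tsumE //; lin. Qed.

End TensorMap.

(* The carrier is not an [algType], whose rings are nontrivial: R may be the zero
   ring here. *)
Record bialgebra (R : comPzRingType) := Bialgebra {
  bcar :> lmodType R;
  bmul : {linear bcar ⊗ bcar -> bcar};
  bunit : {linear R^o -> bcar};
  bcomul : {linear bcar -> bcar ⊗ bcar};
  bcounit : {scalar bcar};
  bmulA : forall a b c : bcar,
    bmul (a ⊗ₜ bmul (b ⊗ₜ c)) = bmul (bmul (a ⊗ₜ b) ⊗ₜ c);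
  bmul1b : forall b : bcar, bmul (bunit 1 ⊗ₜ b) = b;
  bmulb1 : forall b : bcar, bmul (b ⊗ₜ bunit 1) = b;
  bcomulA : forall b : bcar,
    \sw_(b1, b2 <- bcomul b) \sw_(b11, b12 <- bcomul b1) b11 ⊗ₜ (b12 ⊗ₜ b2) =
    \sw_(b1, b2 <- bcomul b) b1 ⊗ₜ bcomul b2;
  bcounitl : forall b : bcar, \sw_(b1, b2 <- bcomul b) bcounit b1 *: b2 = b;
  bcounitr : forall b : bcar, \sw_(b1, b2 <- bcomul b) bcounit b2 *: b1 = b;
  bcomulM : forall a b : bcar,
    bcomul (bmul (a ⊗ₜ b)) =
    \sw_(a1, a2 <- bcomul a) \sw_(b1, b2 <- bcomul b)
      bmul (a1 ⊗ₜ b1) ⊗ₜ bmul (a2 ⊗ₜ b2);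
  bcomul1 : bcomul (bunit 1) = bunit 1 ⊗ₜ bunit 1;
  bcounitM : forall a b : bcar, bcounit (bmul (a ⊗ₜ b)) = bcounit a * bcounit b;
  bcounit1 : bcounit (bunit 1) = 1
}.

Notation "a · b" := (bmul _ (a ⊗ₜ b)) (at level 39, left associativity) : ring_scope.
Notation "'δ' b" := (bcomul _ b) (at level 10, b at level 9) : ring_scope.
Notation "'ε' b" := (bcounit _ b) (at level 10, b at level 9) : ring_scope.

Section Cobraiding.
Variables (R : comPzRingType) (B : bialgebra R).

Definition convolution (σ τ : {scalar B ⊗ B}) (a b : B) : R :=
  \sw_(a1, a2 <- δ a) \sw_(b1, b2 <- δ b) (σ (a1 ⊗ₜ b1) * τ (a2 ⊗ₜ b2) : R^o).

Definition convolution_invertible (σ : {scalar B ⊗ B}) : Prop :=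
  exists τ : {scalar B ⊗ B},
    (forall a b : B, convolution σ τ a b = ε a * ε b) /\
    (forall a b : B, convolution τ σ a b = ε a * ε b).

Record cobraiding := Cobraiding {
  cbr :> {scalar B ⊗ B};
  cbr_inv : convolution_invertible cbr;
  cbr_comm : forall a b : B,
    \sw_(a1, a2 <- δ a) \sw_(b1, b2 <- δ b) cbr (a1 ⊗ₜ b1) *: (b2 · a2) =
    \sw_(a1, a2 <- δ a) \sw_(b1, b2 <- δ b) cbr (a2 ⊗ₜ b2) *: (a1 · b1);
  cbr_mull : forall a b c : B,
    cbr ((a · b) ⊗ₜ c) = \sw_(c1, c2 <- δ c) (cbr (a ⊗ₜ c2) * cbr (b ⊗ₜ c1) : R^o);
  cbr_mulr : forall a b c : B,
    cbr (a ⊗ₜ (b · c)) = \sw_(a1, a2 <- δ a) (cbr (a1 ⊗ₜ b) * cbr (a2 ⊗ₜ c) : R^o)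
}.

End Cobraiding.

Declare Scope cat_scope.
Delimit Scope cat_scope with cat.

Record category := Category {
  obj :> Type;
  hom : obj -> obj -> Type;
  idm : forall X, hom X X;
  comp : forall X Y Z, hom Y Z -> hom X Y -> hom X Z;
  compmA : forall X Y Z W (h : hom Z W) (g : hom Y Z) (f : hom X Y),
    comp h (comp g f) = comp (comp h g) f;
  comp1m : forall X Y (f : hom X Y), comp (idm Y) f = f;
  compm1 : forall X Y (f : hom X Y), comp f (idm X) = f
}.

Notation "g ∘ f" := (comp g f) (at level 50, left associativity) : cat_scope.
Notation "1_ X" := (idm X) (at level 8, X at level 2, format "1_ X") : cat_scope.
Local Open Scope cat_scope.

Definition is_iso (C : category) (X Y : C) (f : hom X Y) : Prop :=
  exists g : hom Y X, g ∘ f = 1_X /\ f ∘ g = 1_Y.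

Record iso (C : category) (X Y : C) := Iso {
  iso_fwd :> hom X Y;
  iso_inv : hom Y X;
  iso_fwdK : iso_inv ∘ iso_fwd = 1_X;
  iso_invK : iso_fwd ∘ iso_inv = 1_Y
}.

Record tensor_category := TensorCategory {
  tc_cat :> category;
  tobj : tc_cat -> tc_cat -> tc_cat;
  tmor : forall X X' Y Y' : tc_cat,
    hom X X' -> hom Y Y' -> hom (tobj X Y) (tobj X' Y');
  tmor1 : forall X Y : tc_cat, tmor 1_X 1_Y = 1_(tobj X Y);
  tmorM : forall (X X' X'' Y Y' Y'' : tc_cat) (f' : hom X' X'') (f : hom X X')
      (g' : hom Y' Y'') (g : hom Y Y'),
    tmor (f' ∘ f) (g' ∘ g) = tmor f' g' ∘ tmor f g
}.

Notation "X ⊙ Y" := (tobj X Y) (at level 40, left associativity) : cat_scope.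
Notation "f ⊡ g" := (tmor f g) (at level 40, left associativity) : cat_scope.

Record skew_monoidal := SkewMonoidal {
  sm_cat :> tensor_category;
  sm_I : sm_cat;
  sm_a : forall X Y Z : sm_cat, hom ((X ⊙ Y) ⊙ Z) (X ⊙ (Y ⊙ Z));
  sm_l : forall X : sm_cat, hom (sm_I ⊙ X) X;
  sm_r : forall X : sm_cat, hom X (X ⊙ sm_I);
  sm_a_nat : forall (X X' Y Y' Z Z' : sm_cat)
      (f : hom X X') (g : hom Y Y') (h : hom Z Z'),
    sm_a X' Y' Z' ∘ ((f ⊡ g) ⊡ h) = (f ⊡ (g ⊡ h)) ∘ sm_a X Y Z;
  sm_l_nat : forall (X X' : sm_cat) (f : hom X X'),
    sm_l X' ∘ (1_sm_I ⊡ f) = f ∘ sm_l X;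
  sm_r_nat : forall (X X' : sm_cat) (f : hom X X'),
    sm_r X' ∘ f = (f ⊡ 1_sm_I) ∘ sm_r X;
  sm_pentagon : forall A B C D : sm_cat,
    sm_a A B (C ⊙ D) ∘ sm_a (A ⊙ B) C D =
    (1_A ⊡ sm_a B C D) ∘ sm_a A (B ⊙ C) D ∘ (sm_a A B C ⊡ 1_D);
  sm_la : forall A B : sm_cat,
    sm_l (A ⊙ B) ∘ sm_a sm_I A B = sm_l A ⊡ 1_B;
  sm_lar : forall A B : sm_cat,
    (1_A ⊡ sm_l B) ∘ sm_a A sm_I B ∘ (sm_r A ⊡ 1_B) = 1_(A ⊙ B);
  sm_ar : forall A B : sm_cat,
    sm_a A B sm_I ∘ sm_r (A ⊙ B) = 1_A ⊡ sm_r B;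
  sm_lr : sm_l sm_I ∘ sm_r sm_I = 1_sm_I
}.

Record skew_braiding (C : skew_monoidal) := SkewBraiding {
  sbr :> forall X A B : C, hom ((X ⊙ A) ⊙ B) ((X ⊙ B) ⊙ A);
  sbr_nat : forall (X X' A A' B B' : C)
      (f : hom X X') (g : hom A A') (h : hom B B'),
    sbr X' A' B' ∘ ((f ⊡ g) ⊡ h) = ((f ⊡ h) ⊡ g) ∘ sbr X A B;
  sbr_iso : forall X A B : C, is_iso (sbr X A B);
  sbr_B1 : forall X A B D : C,
    sbr (X ⊙ D) A B ∘ (sbr X A D ⊡ 1_B) ∘ sbr (X ⊙ A) B D =
    (sbr X B D ⊡ 1_A) ∘ sbr (X ⊙ B) A D ∘ (sbr X A B ⊡ 1_D);
  sbr_B2 : forall X A B D : C,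
    sbr X A (B ⊙ D) ∘ sm_a (X ⊙ A) B D =
    (sm_a X B D ⊡ 1_A) ∘ sbr (X ⊙ B) A D ∘ (sbr X A B ⊡ 1_D);
  sbr_B3 : forall X A B D : C,
    sbr X (A ⊙ B) D ∘ (sm_a X A B ⊡ 1_D) =
    sm_a (X ⊙ D) A B ∘ (sbr X A D ⊡ 1_B) ∘ sbr (X ⊙ A) B D;
  sbr_B4 : forall X A B D : C,
    (1_X ⊡ sbr A B D) ∘ sm_a X (A ⊙ B) D ∘ (sm_a X A B ⊡ 1_D) =
    sm_a X (A ⊙ D) B ∘ (sm_a X A D ⊡ 1_B) ∘ sbr (X ⊙ A) B D
}.

Record monoidal := Monoidal {
  mo_cat :> tensor_category;
  mo_I : mo_cat;
  mo_a : forall X Y Z : mo_cat, iso ((X ⊙ Y) ⊙ Z) (X ⊙ (Y ⊙ Z));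
  mo_l : forall X : mo_cat, iso (mo_I ⊙ X) X;
  mo_r : forall X : mo_cat, iso (X ⊙ mo_I) X;
  mo_a_nat : forall (X X' Y Y' Z Z' : mo_cat)
      (f : hom X X') (g : hom Y Y') (h : hom Z Z'),
    mo_a X' Y' Z' ∘ ((f ⊡ g) ⊡ h) = (f ⊡ (g ⊡ h)) ∘ mo_a X Y Z;
  mo_l_nat : forall (X X' : mo_cat) (f : hom X X'),
    mo_l X' ∘ (1_mo_I ⊡ f) = f ∘ mo_l X;
  mo_r_nat : forall (X X' : mo_cat) (f : hom X X'),
    mo_r X' ∘ (f ⊡ 1_mo_I) = f ∘ mo_r X;
  mo_pentagon : forall A B C D : mo_cat,
    mo_a A B (C ⊙ D) ∘ mo_a (A ⊙ B) C D =
    (1_A ⊡ mo_a B C D) ∘ mo_a A (B ⊙ C) D ∘ (mo_a A B C ⊡ 1_D);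
  mo_triangle : forall A B : mo_cat,
    (1_A ⊡ mo_l B) ∘ mo_a A mo_I B = mo_r A ⊡ 1_B
}.

Record braiding (C : monoidal) := Braiding {
  br :> forall X Y : C, hom (X ⊙ Y) (Y ⊙ X);
  br_nat : forall (X X' Y Y' : C) (f : hom X X') (g : hom Y Y'),
    br X' Y' ∘ (f ⊡ g) = (g ⊡ f) ∘ br X Y;
  br_iso : forall X Y : C, is_iso (br X Y);
  br_hexagon1 : forall X Y Z : C,
    mo_a Y Z X ∘ br X (Y ⊙ Z) ∘ mo_a X Y Z =
    (1_Y ⊡ br X Z) ∘ mo_a Y X Z ∘ (br X Y ⊡ 1_Z);
  br_hexagon2 : forall X Y Z : C,
    iso_inv (mo_a Z X Y) ∘ br (X ⊙ Y) Z ∘ iso_inv (mo_a X Y Z) =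
    (br X Z ⊡ 1_Y) ∘ iso_inv (mo_a X Z Y) ∘ (1_X ⊡ br Y Z)
}.

Section ComputationRules.
Variable R : comPzRingType.
Implicit Types L M N P Q : lmodType R.

Lemma linear_tsum L M N P (phi : {linear N -> P}) (f : L -> M -> N) (t : L ⊗ M) :
  phi (tsum f t) = \sw_(m, n <- t) phi (f m n).
Proof. exact/tsum_out/linearP. Qed.

Lemma mk_tsuml L M N P (f : L -> M -> N) (t : L ⊗ M) (p : P) :
  tsum f t ⊗ₜ p = \sw_(m, n <- t) (f m n ⊗ₜ p).
Proof. by apply: (tsum_out (phi := fun x => x ⊗ₜ p)); lin. Qed.

Lemma mk_tsumr L M N P (f : L -> M -> N) (t : L ⊗ M) (p : P) :
  p ⊗ₜ tsum f t = \sw_(m, n <- t) (p ⊗ₜ f m n).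
Proof. by apply: (tsum_out (phi := fun x => p ⊗ₜ x)); lin. Qed.

Lemma tsum_tsum L M N P Q (g : M -> N -> P) (f : L -> Q -> M ⊗ N) (t : L ⊗ Q) :
  is_bilinear g -> tsum g (tsum f t) = \sw_(x, y <- t) tsum g (f x y).
Proof. by move=> bg; apply: tsum_out; lin. Qed.

Lemma mkZl M N (k : R) (m : M) (n : N) : (k *: m) ⊗ₜ n = k *: (m ⊗ₜ n).
Proof. exact: (linear_funZ ((tens_mk_bilinear M N).1 n)). Qed.

Lemma mkZr M N (k : R) (m : M) (n : N) : m ⊗ₜ (k *: n) = k *: (m ⊗ₜ n).
Proof. exact: (linear_funZ ((tens_mk_bilinear M N).2 m)). Qed.

Variable B : bialgebra R.

Lemma tsum_comulA P (F : B -> B -> B -> P) (b : B) :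
  (forall y z, linear (fun x => F x y z)) ->
  (forall x z, linear (fun y => F x y z)) ->
  (forall x y, linear (fun z => F x y z)) ->
  \sw_(b1, b2 <- δ b) \sw_(b11, b12 <- δ b1) F b11 b12 b2 =
  \sw_(b1, b2 <- δ b) \sw_(b21, b22 <- δ b2) F b1 b21 b22.
Proof.
move=> F1 F2 F3.
pose G (t : B ⊗ (B ⊗ B)) : P := \sw_(x, u <- t) \sw_(y, z <- u) F x y z.
have lG : linear G by rewrite /G; lin.
have := congr1 G (bcomulA b); rewrite !(tsum_out _ _ lG).
have GE x u : G (x ⊗ₜ u) = \sw_(y, z <- u) F x y z by rewrite /G tsumE //; lin.
rewrite [RHS](_ : _ = \sw_(b1, b2 <- δ b) \sw_(y, z <- δ b2) F b1 y z); last first.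
  by apply: eq_tsum => x y; rewrite GE.
move=> <-; apply: eq_tsum => x y; rewrite (tsum_out _ _ lG).
by apply: eq_tsum => z w; rewrite GE tsumE //; lin.
Qed.

Lemma tsum_counitl P (g : B -> P) (b : B) : linear g ->
  \sw_(b1, b2 <- δ b) ε b1 *: g b2 = g b.
Proof.
move=> lg; rewrite -[in RHS](bcounitl b) (tsum_out _ _ lg).
by apply: eq_tsum => x y; rewrite (linear_funZ lg).
Qed.

Lemma tsum_counitr P (g : B -> P) (b : B) : linear g ->
  \sw_(b1, b2 <- δ b) ε b2 *: g b1 = g b.
Proof.
move=> lg; rewrite -[in RHS](bcounitr b) (tsum_out _ _ lg).
by apply: eq_tsum => x y; rewrite (linear_funZ lg).
Qed.

Lemma tsum_comulM P (F : B -> B -> P) (a b : B) : is_bilinear F ->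
  tsum F (δ (a · b)) =
  \sw_(a1, a2 <- δ a) \sw_(b1, b2 <- δ b) F (a1 · b1) (a2 · b2).
Proof.
move=> bF; rewrite bcomulM tsum_tsum //; apply: eq_tsum => x y.
by rewrite tsum_tsum //; apply: eq_tsum => z w; rewrite tsumE.
Qed.

Lemma tsum_comul1 P (F : B -> B -> P) : is_bilinear F ->
  tsum F (δ (bunit B 1)) = F (bunit B 1) (bunit B 1).
Proof. by move=> bF; rewrite bcomul1 tsumE. Qed.

End ComputationRules.

Ltac tens_elim x a b :=
  move: x;
  match goal with |- forall x, @?L x = @?R x =>
    refine (tens_linear_eq (f := L) (g := R) _ _ _) end;
  [by lin | by lin | move=> a b; cbv beta].

Section RMod.
Variable R : comPzRingType.

Definition RMod : category.
Proof.
refine (@Category (lmodType R) (fun M N => {linear M -> N}) (@lin_idm R)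
  (fun M N P g f => lin_compm g f) _ _ _) => *; exact: linear_ext.
Defined.

End RMod.

(* X ⊗ B ⊗ Y is bracketed as X ⊗ (B ⊗ Y). *)

Section RModB.
Variables (R : comPzRingType) (B : bialgebra R).
Implicit Types X Y Z : lmodType R.

Definition star X Y : lmodType R := X ⊗ (B ⊗ Y).

Definition starm X X' Y Y' (f : {linear X -> X'}) (g : {linear Y -> Y'}) :
  {linear star X Y -> star X' Y'} := tmap f (tmap (lin_idm B) g).

Lemma starmE X X' Y Y' (f : {linear X -> X'}) (g : {linear Y -> Y'}) x b y :
  starm f g (x ⊗ₜ (b ⊗ₜ y)) = f x ⊗ₜ (b ⊗ₜ g y).
Proof. by rewrite /starm !tmapE. Qed.

Definition star_assoc_fun X Y Z (t : star (star X Y) Z) : star X (star Y Z) :=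
  \sw_(u, v <- t) \sw_(x, p <- u) \sw_(b, y <- p) \sw_(c, z <- v)
    \sw_(c1, c2 <- δ c) x ⊗ₜ ((b · c1) ⊗ₜ (y ⊗ₜ (c2 ⊗ₜ z))).

Lemma star_assoc_linear X Y Z : linear (@star_assoc_fun X Y Z).
Proof. by rewrite /star_assoc_fun; lin. Qed.

Definition star_assoc X Y Z : {linear star (star X Y) Z -> star X (star Y Z)} :=
  mk_linear (@star_assoc_linear X Y Z).

Lemma star_assocE X Y Z (x : X) b (y : Y) c (z : Z) :
  star_assoc X Y Z ((x ⊗ₜ (b ⊗ₜ y)) ⊗ₜ (c ⊗ₜ z)) =
  \sw_(c1, c2 <- δ c) x ⊗ₜ ((b · c1) ⊗ₜ (y ⊗ₜ (c2 ⊗ₜ z))).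
Proof.
rewrite /star_assoc mk_linearE /star_assoc_fun.
by do 4 (rewrite tsumE; last by lin).
Qed.

Definition star_lunit_fun X (t : star R^o X) : X :=
  tsum (M := R^o) (fun k p => \sw_(b, x <- p) (k : R) *: (ε b *: x)) t.

Lemma star_lunit_linear X : linear (@star_lunit_fun X).
Proof. by rewrite /star_lunit_fun; lin. Qed.

Definition star_lunit X : {linear star R^o X -> X} := mk_linear (@star_lunit_linear X).

Lemma star_lunitE X (k : R^o) b (x : X) : star_lunit X (k ⊗ₜ (b ⊗ₜ x)) = (k : R) *: (ε b *: x).
Proof.
rewrite /star_lunit mk_linearE /star_lunit_fun.
by do 2 (rewrite tsumE; last by lin).
Qed.

Lemma star_runit_linear X :
  linear (fun x : X => x ⊗ₜ (bunit B 1 ⊗ₜ (1 : R^o)) : star X R^o).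
Proof. by lin. Qed.

Definition star_runit X : {linear X -> star X R^o} := mk_linear (@star_runit_linear X).

Lemma star_runitE X (x : X) : star_runit X x = x ⊗ₜ (bunit B 1 ⊗ₜ (1 : R^o)).
Proof. by []. Qed.

Definition RModB_tensor : tensor_category.
Proof.
refine (@TensorCategory (RMod R) star (fun X X' Y Y' f g => starm f g) _ _).
  move=> X Y; apply: linear_ext => t; tens_elim t x p; tens_elim p b y.
  by rewrite starmE.
move=> X X' X'' Y Y' Y'' f' f g' g; apply: linear_ext => t.
rewrite lin_compmE; tens_elim t x p; tens_elim p b y.
by rewrite !starmE !lin_compmE.
Defined.

End RModB.

Section RModBSkew.
Variables (R : comPzRingType) (B : bialgebra R).
Implicit Types X Y Z : lmodType R.

Lemma star_assoc_nat X X' Y Y' Z Z' (f : {linear X -> X'}) (g : {linear Y -> Y'})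
    (h : {linear Z -> Z'}) t :
  star_assoc B X' Y' Z' (starm B (starm B f g) h t) =
  starm B f (starm B g h) (star_assoc B X Y Z t).
Proof.
tens_elim t u v; tens_elim u x p; tens_elim p b y; tens_elim v c z.
rewrite !starmE !star_assocE (linear_tsum (starm _ _ _)); apply: eq_tsum => c1 c2.
by rewrite !starmE.
Qed.

Lemma star_lunit_nat X X' (f : {linear X -> X'}) t :
  star_lunit B X' (starm B (lin_idm R^o) f t) = f (star_lunit B X t).
Proof.
tens_elim t k p; tens_elim p b x.
by rewrite starmE !star_lunitE lin_idmE (linZ f k) (linZ f (ε b)).
Qed.

Lemma star_runit_nat X X' (f : {linear X -> X'}) x :
  star_runit B X' (f x) = starm B f (lin_idm R^o) (star_runit B X x).
Proof. by rewrite !star_runitE starmE. Qed.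

Lemma star_pentagon (X Y Z W : lmodType R) t :
  star_assoc B X Y (star B Z W) (star_assoc B (star B X Y) Z W t) =
  starm B (lin_idm X) (star_assoc B Y Z W) (star_assoc B X (star B Y Z) W
    (starm B (star_assoc B X Y Z) (lin_idm W) t)).
Proof.
tens_elim t u v; tens_elim v d w; tens_elim u u' q; tens_elim q c z.
tens_elim u' x p; tens_elim p b y.
rewrite starmE !star_assocE lin_idmE mk_tsuml.
rewrite !(linear_tsum (star_assoc B _ _ _)) (linear_tsum (starm _ _ _)).
pose F (c1 c2 d1 d2 d3 : B) : star B X (star B Y (star B Z W)) :=
  x ⊗ₜ ((b · (c1 · d1)) ⊗ₜ (y ⊗ₜ ((c2 · d2) ⊗ₜ (z ⊗ₜ (d3 ⊗ₜ w))))).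
transitivity (\sw_(d1, d2 <- δ d) \sw_(d11, d12 <- δ d1) \sw_(c1, c2 <- δ c)
    F c1 c2 d11 d12 d2).
  apply: eq_tsum => d1 d2; rewrite star_assocE tsum_comulM; last by lin.
  by rewrite tsum_exchange.
rewrite (tsum_comulA (F := fun d1 d2 d3 => \sw_(c1, c2 <- δ c) F c1 c2 d1 d2 d3));
  [|by move=> *; rewrite /F; lin..].
transitivity (\sw_(c1, c2 <- δ c) \sw_(d1, d2 <- δ d) \sw_(d21, d22 <- δ d2)
    F c1 c2 d1 d21 d22).
  rewrite tsum_exchange; apply: eq_tsum => d1 d2.
  by rewrite tsum_exchange.
apply: eq_tsum => c1 c2; rewrite star_assocE (linear_tsum (starm _ _ _)).
apply: eq_tsum => d1 d2; rewrite starmE star_assocE !mk_tsumr.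
by apply: eq_tsum => d21 d22; rewrite /F bmulA.
Qed.

Lemma star_la X Y t :
  star_lunit B (star B X Y) (star_assoc B R^o X Y t) =
  starm B (star_lunit B X) (lin_idm Y) t.
Proof.
tens_elim t u v; tens_elim u k p; tens_elim p b x; tens_elim v c y.
rewrite starmE star_assocE (linear_tsum (star_lunit _ _)) star_lunitE !mkZl.
rewrite -(tsum_counitl (g := fun c' => (k : R) *: (ε b *: (x ⊗ₜ (c' ⊗ₜ y))))); last by lin.
apply: eq_tsum => c1 c2; rewrite star_lunitE bcounitM.
rewrite !scalerA; congr (_ *: _).
by rewrite [LHS]mulrA [LHS]mulrC [LHS]mulrA.
Qed.

Lemma star_lar X Y t :
  starm B (lin_idm X) (star_lunit B Y) (star_assoc B X R^o Y
    (starm B (star_runit B X) (lin_idm Y) t)) = t.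
Proof.
tens_elim t x p; tens_elim p c y.
rewrite starmE star_runitE star_assocE (linear_tsum (starm _ _ _)).
rewrite -[RHS](tsum_counitr (g := fun c' => x ⊗ₜ (c' ⊗ₜ y))); last by lin.
apply: eq_tsum => c1 c2.
by rewrite starmE star_lunitE scale1r bmul1b !mkZr.
Qed.

Lemma star_ar X Y t :
  star_assoc B X Y R^o (star_runit B (star B X Y) t) =
  starm B (lin_idm X) (star_runit B Y) t.
Proof.
tens_elim t x p; tens_elim p b y.
rewrite star_runitE starmE star_assocE tsum_comul1; last by lin.
by rewrite bmulb1 star_runitE.
Qed.

Lemma star_lr k : star_lunit B R^o (star_runit B R^o k) = k.
Proof. by rewrite star_runitE star_lunitE bcounit1 scale1r; apply: mulr1. Qed.

Ltac hom_unfold :=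
  cbv beta iota delta [comp tmor tobj idm hom obj tc_cat RModB_tensor RMod].

Definition RModB : skew_monoidal.
Proof.
refine (@SkewMonoidal (RModB_tensor B) (R^o : lmodType R)
  (star_assoc B) (star_lunit B) (star_runit B) _ _ _ _ _ _ _ _).
- move=> X X' Y Y' Z Z' f g h; hom_unfold; apply: linear_ext => t; rewrite ?lin_compmE; exact: (star_assoc_nat f g h t).
- move=> X X' f; hom_unfold; apply: linear_ext => t; rewrite ?lin_compmE; exact: (star_lunit_nat f t).
- move=> X X' f; hom_unfold; apply: linear_ext => t; rewrite ?lin_compmE; exact: (star_runit_nat f t).
- move=> X Y Z W; hom_unfold; apply: linear_ext => t; rewrite ?lin_compmE; exact: (star_pentagon t).
- move=> X Y; hom_unfold; apply: linear_ext => t; rewrite ?lin_compmE; exact: (star_la t).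
- move=> X Y; hom_unfold; apply: linear_ext => t; rewrite ?lin_compmE; exact: (star_lar t).
- move=> X Y; hom_unfold; apply: linear_ext => t; rewrite ?lin_compmE; exact: (star_ar t).
- hom_unfold; apply: linear_ext => t; rewrite ?lin_compmE; exact: (star_lr t).
Defined.

End RModBSkew.

Section TensorIso.
Variable R : comPzRingType.
Implicit Types M N P : lmodType R.

Definition tassoc_fun M N P (t : (M ⊗ N) ⊗ P) : M ⊗ (N ⊗ P) :=
  \sw_(u, z <- t) \sw_(x, y <- u) x ⊗ₜ (y ⊗ₜ z).
Definition tassoc_inv_fun M N P (t : M ⊗ (N ⊗ P)) : (M ⊗ N) ⊗ P :=
  \sw_(x, u <- t) \sw_(y, z <- u) (x ⊗ₜ y) ⊗ₜ z.
Definition tlunit_fun M (t : R^o ⊗ M) : M := tsum (M := R^o) (fun k x => (k : R) *: x) t.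
Definition trunit_fun M (t : M ⊗ R^o) : M := tsum (N := R^o) (fun x k => (k : R) *: x) t.

Lemma tassoc_linear M N P : linear (@tassoc_fun M N P).
Proof. by rewrite /tassoc_fun; lin. Qed.
Lemma tassoc_inv_linear M N P : linear (@tassoc_inv_fun M N P).
Proof. by rewrite /tassoc_inv_fun; lin. Qed.
Lemma tlunit_bilinear M : @is_bilinear R R^o M M (fun k x => (k : R) *: x).
Proof. by lin. Qed.
Lemma trunit_bilinear M : @is_bilinear R M R^o M (fun x k => (k : R) *: x).
Proof. by lin. Qed.

Definition tassoc M N P : {linear (M ⊗ N) ⊗ P -> M ⊗ (N ⊗ P)} :=
  mk_linear (@tassoc_linear M N P).
Definition tassoc_inv M N P : {linear M ⊗ (N ⊗ P) -> (M ⊗ N) ⊗ P} :=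
  mk_linear (@tassoc_inv_linear M N P).
Definition tlunit M : {linear R^o ⊗ M -> M} :=
  mk_linear (tsum_linear (tlunit_bilinear M) : linear (@tlunit_fun M)).
Definition trunit M : {linear M ⊗ R^o -> M} :=
  mk_linear (tsum_linear (trunit_bilinear M) : linear (@trunit_fun M)).

Lemma tlunit_inv_linear M : linear (fun x : M => (1 : R^o) ⊗ₜ x : R^o ⊗ M).
Proof. by lin. Qed.
Lemma trunit_inv_linear M : linear (fun x : M => x ⊗ₜ (1 : R^o) : M ⊗ R^o).
Proof. by lin. Qed.
Definition tlunit_inv M : {linear M -> R^o ⊗ M} := mk_linear (@tlunit_inv_linear M).
Definition trunit_inv M : {linear M -> M ⊗ R^o} := mk_linear (@trunit_inv_linear M).

Lemma tassocE M N P x y z : tassoc M N P ((x ⊗ₜ y) ⊗ₜ z) = x ⊗ₜ (y ⊗ₜ z).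
Proof.
by rewrite /tassoc mk_linearE /tassoc_fun; do 2 (rewrite tsumE; last by lin).
Qed.
Lemma tassoc_invE M N P x y z : tassoc_inv M N P (x ⊗ₜ (y ⊗ₜ z)) = (x ⊗ₜ y) ⊗ₜ z.
Proof.
by rewrite /tassoc_inv mk_linearE /tassoc_inv_fun; do 2 (rewrite tsumE; last by lin).
Qed.
Lemma tlunitE M (k : R^o) (x : M) : tlunit M (k ⊗ₜ x) = (k : R) *: x.
Proof. by rewrite /tlunit mk_linearE /tlunit_fun tsumE //; apply: tlunit_bilinear. Qed.
Lemma trunitE M (k : R^o) (x : M) : trunit M (x ⊗ₜ k) = (k : R) *: x.
Proof. by rewrite /trunit mk_linearE /trunit_fun tsumE //; apply: trunit_bilinear. Qed.
Lemma tlunit_invE M (x : M) : tlunit_inv M x = (1 : R^o) ⊗ₜ x.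
Proof. by []. Qed.
Lemma trunit_invE M (x : M) : trunit_inv M x = x ⊗ₜ (1 : R^o).
Proof. by []. Qed.

Lemma tassocK M N P t : tassoc_inv M N P (tassoc M N P t) = t.
Proof. by tens_elim t u z; tens_elim u x y; rewrite tassocE tassoc_invE. Qed.
Lemma tassoc_invK M N P t : tassoc M N P (tassoc_inv M N P t) = t.
Proof. by tens_elim t x u; tens_elim u y z; rewrite tassoc_invE tassocE. Qed.

Lemma regular_scale1 (k : R^o) : (k : R) *: (1 : R^o) = k.
Proof. exact: mulr1. Qed.

Lemma tlunitK M t : tlunit_inv M (tlunit M t) = t.
Proof.
by tens_elim t k x; rewrite tlunitE tlunit_invE mkZr -mkZl regular_scale1.
Qed.
Lemma tlunit_invK M x : tlunit M (tlunit_inv M x) = x.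
Proof. by rewrite tlunit_invE tlunitE scale1r. Qed.
Lemma trunitK M t : trunit_inv M (trunit M t) = t.
Proof.
by tens_elim t x k; rewrite trunitE trunit_invE mkZl -mkZr regular_scale1.
Qed.
Lemma trunit_invK M x : trunit M (trunit_inv M x) = x.
Proof. by rewrite trunit_invE trunitE scale1r. Qed.

End TensorIso.

Section Comodules.
Variables (R : comPzRingType) (B : bialgebra R).

Record comodule := Comodule {
  cm_car :> lmodType R;
  coact : {linear cm_car -> B ⊗ cm_car};
  coactA : forall x : cm_car,
    \sw_(b, y <- coact x) \sw_(b1, b2 <- δ b) b1 ⊗ₜ (b2 ⊗ₜ y) =
    \sw_(b, y <- coact x) b ⊗ₜ coact y;
  coact1 : forall x : cm_car, \sw_(b, y <- coact x) ε b *: y = x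
}.

Record comod_hom (M N : comodule) := ComodHom {
  ch_fun :> {linear M -> N};
  ch_coact : forall x : M, coact N (ch_fun x) = \sw_(b, y <- coact M x) b ⊗ₜ ch_fun y
}.

Lemma comod_hom_ext (M N : comodule) (f g : comod_hom M N) :
  (forall x, f x = g x) -> f = g.
Proof.
case: f g => [f fc] [g gc] /= fg.
have {}fg : f = g by exact: linear_ext.
by subst g; rewrite (Prop_irrelevance fc gc).
Qed.

Lemma tsum_coactA (M : comodule) (P : lmodType R) (F : B -> B -> M -> P) (x : M) :
  (forall b y, linear (fun a => F a b y)) ->
  (forall a y, linear (fun b => F a b y)) ->
  (forall a b, linear (fun y => F a b y)) ->
  \sw_(b, y <- coact M x) \sw_(b1, b2 <- δ b) F b1 b2 y =
  \sw_(b, y <- coact M x) \sw_(c, z <- coact M y) F b c z.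
Proof.
move=> F1 F2 F3.
pose G (t : B ⊗ (B ⊗ M)) : P := \sw_(a, u <- t) \sw_(b, y <- u) F a b y.
have lG : linear G by rewrite /G; lin.
have := congr1 G (coactA x); rewrite !(tsum_out _ _ lG).
have GE a u : G (a ⊗ₜ u) = \sw_(b, y <- u) F a b y by rewrite /G tsumE //; lin.
rewrite [RHS](_ : _ = \sw_(b, y <- coact M x) \sw_(c, z <- coact M y) F b c z); last first.
  by apply: eq_tsum => b y; rewrite GE.
move=> <-; apply: eq_tsum => b y; rewrite (tsum_out _ _ lG).
by apply: eq_tsum => c z; rewrite GE tsumE //; lin.
Qed.

Lemma comod_idm_coact (M : comodule) (x : M) :
  coact M (lin_idm M x) = \sw_(b, y <- coact M x) b ⊗ₜ lin_idm M y.
Proof. by rewrite lin_idmE -[LHS]tsum_mk. Qed.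

Definition comod_idm (M : comodule) : comod_hom M M := ComodHom (@comod_idm_coact M).

Lemma comod_comp_coact (M N P : comodule) (g : comod_hom N P) (f : comod_hom M N) x :
  coact P (lin_compm g f x) = \sw_(b, y <- coact M x) b ⊗ₜ lin_compm g f y.
Proof.
rewrite lin_compmE (ch_coact g) (ch_coact f) tsum_tsum; last by lin.
by apply: eq_tsum => b y; rewrite tsumE //; lin.
Qed.

Definition comod_comp (M N P : comodule) (g : comod_hom N P) (f : comod_hom M N) :
  comod_hom M P := ComodHom (comod_comp_coact g f).

Definition Comod : category.
Proof.
refine (@Category comodule comod_hom comod_idm comod_comp _ _ _) => *;
  exact: comod_hom_ext.
Defined.

Section TensorComodule.
Variables M N : comodule.

Definition tens_coact_fun (t : M ⊗ N) : B ⊗ (M ⊗ N) :=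
  \sw_(x, y <- t) \sw_(b, v <- coact M x) \sw_(c, w <- coact N y)
    (b · c) ⊗ₜ (v ⊗ₜ w).

Lemma tens_coact_linear : linear tens_coact_fun.
Proof. by rewrite /tens_coact_fun; lin. Qed.

Definition tens_coact : {linear M ⊗ N -> B ⊗ (M ⊗ N)} := mk_linear tens_coact_linear.

Lemma tens_coactE x y : tens_coact (x ⊗ₜ y) =
  \sw_(b, v <- coact M x) \sw_(c, w <- coact N y) (b · c) ⊗ₜ (v ⊗ₜ w).
Proof. by rewrite /tens_coact mk_linearE /tens_coact_fun tsumE //; lin. Qed.

Lemma tsum_tens_coact (P : lmodType R) (F : B -> M ⊗ N -> P) x y : is_bilinear F ->
  tsum F (tens_coact (x ⊗ₜ y)) =
  \sw_(b, v <- coact M x) \sw_(c, w <- coact N y) F (b · c) (v ⊗ₜ w).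
Proof.
move=> bF; rewrite tens_coactE tsum_tsum //; apply: eq_tsum => b v.
by rewrite tsum_tsum //; apply: eq_tsum => c w; rewrite tsumE.
Qed.

Lemma tens_coactA t :
  \sw_(b, y <- tens_coact t) \sw_(b1, b2 <- δ b) b1 ⊗ₜ (b2 ⊗ₜ y) =
  \sw_(b, y <- tens_coact t) b ⊗ₜ tens_coact y.
Proof.
tens_elim t x y; rewrite !tsum_tens_coact; [|by lin..].
pose F (b1 b2 c1 c2 : B) (v : M) (w : N) : B ⊗ (B ⊗ (M ⊗ N)) :=
  (b1 · c1) ⊗ₜ ((b2 · c2) ⊗ₜ (v ⊗ₜ w)).
transitivity (\sw_(b, v <- coact M x) \sw_(b1, b2 <- δ b)
    \sw_(c, w <- coact N y) \sw_(c1, c2 <- δ c) F b1 b2 c1 c2 v w).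
  apply: eq_tsum => b v; rewrite -tsum_exchange; apply: eq_tsum => c w.
  by rewrite tsum_comulM //; lin.
rewrite (tsum_coactA (F := fun b1 b2 v => \sw_(c, w <- coact N y)
  \sw_(c1, c2 <- δ c) F b1 b2 c1 c2 v w)); [|by move=> *; rewrite /F; lin..].
apply: eq_tsum => b v.
transitivity (\sw_(c, w <- coact N y) \sw_(b2, v' <- coact M v)
    \sw_(c2, w' <- coact N w) F b b2 c c2 v' w').
  rewrite [RHS]tsum_exchange; apply: eq_tsum => b2 v'.
  rewrite (tsum_coactA (F := fun c1 c2 w => F b b2 c1 c2 v' w)) //;
    by move=> *; rewrite /F; lin.
apply: eq_tsum => c w; rewrite tens_coactE !mk_tsumr; apply: eq_tsum => b2 v'.
by rewrite mk_tsumr.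
Qed.

Lemma tens_coact1 t : \sw_(b, y <- tens_coact t) ε b *: y = t.
Proof.
tens_elim t x y; rewrite tsum_tens_coact; last by lin.
rewrite -[in RHS](coact1 x) mk_tsuml; apply: eq_tsum => b v.
rewrite -[in RHS](coact1 y) mk_tsumr; apply: eq_tsum => c w.
by rewrite bcounitM mkZl mkZr scalerA.
Qed.

Definition tens_comodule : comodule := Comodule tens_coactA tens_coact1.

End TensorComodule.

Lemma tmap_coact (M M' N N' : comodule) (f : comod_hom M M') (g : comod_hom N N') t :
  tens_coact M' N' (tmap f g t) = \sw_(b, y <- tens_coact M N t) b ⊗ₜ tmap f g y.
Proof.
tens_elim t x y; rewrite tmapE tens_coactE tsum_tens_coact; last by lin.
rewrite (ch_coact f) tsum_tsum; last by lin.
apply: eq_tsum => b v; rewrite tsumE; last by lin.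
rewrite (ch_coact g) tsum_tsum; last by lin.
apply: eq_tsum => c w; rewrite tsumE; last by lin.
by rewrite tmapE.
Qed.

Definition tens_comod_hom (M M' N N' : comodule) (f : comod_hom M M')
    (g : comod_hom N N') : comod_hom (tens_comodule M N) (tens_comodule M' N') :=
  @ComodHom (tens_comodule M N) (tens_comodule M' N') (tmap f g) (tmap_coact f g).

Lemma unit_coact_linear : linear (fun k : R^o => bunit B 1 ⊗ₜ k : B ⊗ R^o).
Proof. by lin. Qed.

Definition unit_coact : {linear R^o -> B ⊗ R^o} := mk_linear unit_coact_linear.

Lemma unit_coactE k : unit_coact k = bunit B 1 ⊗ₜ k.
Proof. by []. Qed.

Lemma unit_coactA k :
  \sw_(b, y <- unit_coact k) \sw_(b1, b2 <- δ b) b1 ⊗ₜ (b2 ⊗ₜ y) =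
  \sw_(b, y <- unit_coact k) b ⊗ₜ unit_coact y.
Proof.
rewrite unit_coactE !tsumE; [|by lin..].
by rewrite tsum_comul1 //; lin.
Qed.

Lemma unit_coact1 k : \sw_(b, y <- unit_coact k) ε b *: y = k.
Proof. by rewrite unit_coactE tsumE ?bcounit1 ?scale1r //; lin. Qed.

Definition unit_comodule : comodule := Comodule unit_coactA unit_coact1.

Definition Comod_tensor : tensor_category.
Proof.
refine (@TensorCategory Comod tens_comodule tens_comod_hom _ _).
- move=> M N; apply: comod_hom_ext => t; change (tmap (lin_idm M) (lin_idm N) t = t).
  by tens_elim t x y; rewrite tmapE.
- move=> M M' M'' N N' N'' f' f g' g; apply: comod_hom_ext => t.
  change (tmap (lin_compm f' f) (lin_compm g' g) t = tmap f' g' (tmap f g t)).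
  by tens_elim t x y; rewrite !tmapE !lin_compmE.
Defined.

End Comodules.

Section ComodMonoidal.
Variables (R : comPzRingType) (B : bialgebra R).
Implicit Types M N P : comodule B.

Lemma comod_inv_coact M N (f : comod_hom M N) (g : {linear N -> M}) :
  (forall x, g (f x) = x) -> (forall y, f (g y) = y) ->
  forall y, coact M (g y) = \sw_(b, z <- coact N y) b ⊗ₜ g z.
Proof.
move=> fK gK y; rewrite -{2}(gK y) (ch_coact f) tsum_tsum; last by lin.
rewrite -[LHS]tsum_mk; apply: eq_tsum => b z; rewrite tsumE; last by lin.
by rewrite fK.
Qed.

Definition comod_iso M N (f : comod_hom M N) (g : {linear N -> M})
    (fK : forall x, g (f x) = x) (gK : forall y, f (g y) = y) :
  @iso (Comod B) M N :=
  @Iso (Comod B) M N f (ComodHom (comod_inv_coact fK gK))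
    (comod_hom_ext (f := comod_comp (ComodHom (comod_inv_coact fK gK)) f)
       (g := comod_idm M) fK)
    (comod_hom_ext (f := comod_comp f (ComodHom (comod_inv_coact fK gK)))
       (g := comod_idm N) gK).

Lemma coact_tensE M N : coact (tens_comodule M N) = tens_coact M N.
Proof. by []. Qed.

Lemma coact_unitE : coact (unit_comodule B) = unit_coact B.
Proof. by []. Qed.

Lemma tassoc_coact M N P t :
  tens_coact M (tens_comodule N P) (tassoc M N P t) =
  \sw_(b, y <- tens_coact (tens_comodule M N) P t) b ⊗ₜ tassoc M N P y.
Proof.
tens_elim t u z; tens_elim u x y.
rewrite tassocE tens_coactE.
rewrite (tsum_tens_coact (M := tens_comodule M N) (N := P)); last by lin.
rewrite !coact_tensE tsum_tens_coact; last by lin.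
apply: eq_tsum => b v; rewrite tsum_tens_coact; last by lin.
by apply: eq_tsum => c w; apply: eq_tsum => d s; rewrite tassocE bmulA.
Qed.

Lemma tlunit_coact M t :
  coact M (tlunit M t) = \sw_(b, y <- tens_coact (unit_comodule B) M t) b ⊗ₜ tlunit M y.
Proof.
tens_elim t k x; rewrite (tsum_tens_coact (M := unit_comodule B) (N := M)); last by lin.
rewrite coact_unitE unit_coactE tsumE; last by lin.
rewrite tlunitE (linZ (coact M) k) -[in LHS](tsum_mk (coact M x)).
rewrite (tsum_out (phi := fun y => (k : R) *: y)); last by lin.
by apply: eq_tsum => b y; rewrite bmul1b tlunitE mkZr.
Qed.

Lemma trunit_coact M t :
  coact M (trunit M t) = \sw_(b, y <- tens_coact M (unit_comodule B) t) b ⊗ₜ trunit M y.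
Proof.
tens_elim t x k; rewrite (tsum_tens_coact (M := M) (N := unit_comodule B)); last by lin.
rewrite trunitE (linZ (coact M) k) -[in LHS](tsum_mk (coact M x)).
rewrite (tsum_out (phi := fun y => (k : R) *: y)); last by lin.
apply: eq_tsum => b y.
rewrite coact_unitE unit_coactE tsumE; last by lin.
by rewrite bmulb1 trunitE mkZr.
Qed.

Definition comod_assoc M N P :=
  comod_iso (f := @ComodHom _ _ (tens_comodule (tens_comodule M N) P)
                    (tens_comodule M (tens_comodule N P)) (tassoc M N P)
                    (@tassoc_coact M N P))
    (@tassocK R M N P) (@tassoc_invK R M N P).

Definition comod_lunit M :=
  comod_iso (f := @ComodHom _ _ (tens_comodule (unit_comodule B) M) M (tlunit M)
                    (@tlunit_coact M))
    (@tlunitK R M) (@tlunit_invK R M).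

Definition comod_runit M :=
  comod_iso (f := @ComodHom _ _ (tens_comodule M (unit_comodule B)) M (trunit M)
                    (@trunit_coact M))
    (@trunitK R M) (@trunit_invK R M).

Definition ComodB : monoidal.
Proof.
refine (@Monoidal (Comod_tensor B) (unit_comodule B)
  comod_assoc comod_lunit comod_runit _ _ _ _ _).
- move=> M M' N N' P P' f g h; apply: comod_hom_ext => t.
  change (tassoc M' N' P' (tmap (tmap f g) h t) = tmap f (tmap g h) (tassoc M N P t)).
  by tens_elim t u z; tens_elim u x y; rewrite !tmapE !tassocE !tmapE.
- move=> M M' f; apply: comod_hom_ext => t.
  change (tlunit M' (tmap (lin_idm R^o) f t) = f (tlunit M t)).
  by tens_elim t k x; rewrite tmapE !tlunitE (linZ f k).
- move=> M M' f; apply: comod_hom_ext => t.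
  change (trunit M' (tmap f (lin_idm R^o) t) = f (trunit M t)).
  by tens_elim t x k; rewrite tmapE !trunitE (linZ f k).
- move=> M N P Q; apply: comod_hom_ext => t.
  change (tassoc M N (P ⊗ Q) (tassoc (M ⊗ N) P Q t) =
    tmap (lin_idm M) (tassoc N P Q) (tassoc M (N ⊗ P) Q
      (tmap (tassoc M N P) (lin_idm Q) t))).
  tens_elim t u w; tens_elim u v z; tens_elim v x y.
  by rewrite tmapE !tassocE tmapE tassocE.
- move=> M N; apply: comod_hom_ext => t.
  change (tmap (lin_idm M) (tlunit N) (tassoc M R^o N t) =
    tmap (trunit M) (lin_idm N) t).
  tens_elim t u y; tens_elim u x k.
  by rewrite tassocE !tmapE tlunitE trunitE mkZl mkZr.
Defined.

End ComodMonoidal.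

(* Main.v *)
(* Everything is encoded by one operator on B ⊗ B: a cobraiding σ gives
   S(b ⊗ c) = Σ σ(b1, c1) c2 ⊗ b2, which is invertible because σ is invertible for
   convolution, and σ = (ε ⊗ ε) S.  On comodules the braiding is
   x ⊗ y |-> Σ σ(x_(-1), y_(-1)) y_(0) ⊗ x_(0); on R-Mod[B] the skew braiding is
   X ⊗ β(GA, GC), with GA = B ⊗ A the cofree comodule and β the braiding of comodules.

   Conversely, a braiding of comodules is determined by its value S on the regular
   comodule, by naturality along the coactions M -> B ⊗ M and the maps b |-> b ⊗ x;
   a skew braiding is determined by its value S at X = A = C = R, by naturality along
   the maps R -> X.  In the skew case, applying ε to one tensor factor of (B2) and (B3)
   gives S(b ⊗ cd) and S(bc ⊗ d) in terms of S; since S is onto, these force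
   S(b ⊗ 1) = 1 ⊗ b and S(1 ⊗ d) = d ⊗ 1, and then (B2) and (B3), with ε applied to the
   other factors, make S colinear in both arguments, which is the formula above.  The
   axioms of a cobraiding are the images under counits of (B2), (B3), (B4), or of the
   two hexagons and the colinearity of the braiding. *)

From HB Require Import structures.
From mathcomp Require Import all_boot all_algebra.
From mathcomp Require Import boolp.
Require Import Defs.

Set Implicit Arguments.
Unset Strict Implicit.
Unset Printing Implicit Defensive.

Import GRing.Theory.
Local Open Scope ring_scope.

(** * Sums and linear forms with values in the base ring *)

Section Sums.
Variable R : comPzRingType.
Implicit Types L M N P : lmodType R.

Lemma scale_tsuml M N P (f : M -> N -> R) (t : M ⊗ N) (v : P) :
  (tsum (f : M -> N -> R^o) t : R) *: v = \sw_(m, n <- t) (f m n *: v).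
Proof. exact: scaler_suml. Qed.

Lemma scale_tsumr M N P (f : M -> N -> P) (t : M ⊗ N) (k : R) :
  k *: tsum f t = \sw_(m, n <- t) (k *: f m n).
Proof. exact: scaler_sumr. Qed.

Lemma eq_tsum_form M N (f g : M -> N -> R) (t : M ⊗ N) :
  (forall m n, f m n = g m n) ->
  tsum (f : M -> N -> R^o) t = tsum (g : M -> N -> R^o) t :> R.
Proof. by move=> fg; apply: (@eq_tsum R M N R^o). Qed.

Lemma mul_tsuml M N (f : M -> N -> R) (t : M ⊗ N) (k : R) :
  ((tsum (f : M -> N -> R^o) t : R) * k : R) = (\sw_(m, n <- t) (f m n * k : R^o)).
Proof. exact: mulr_suml. Qed.

Lemma scalar_ext M (f g : {scalar M}) : f =1 g -> f = g.
Proof.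
move=> fg; have /funext {fg} : (f : M -> R) =1 g by [].
case: f g => [f [[f1] [f2]]] [g [[g1] [g2]]] /= fg; subst g.
by rewrite (Prop_irrelevance f1 g1) (Prop_irrelevance f2 g2).
Qed.

(** [{scalar M}] is linear for the multiplication of [R], while the linearity rules speak of maps
    into the module [R^o]; the two scalings are convertible, so [lf] serves for both. *)
Definition mk_scalar M (f : M -> R) (lf : linear (f : M -> R^o)) : {scalar M} :=
  HB.pack_for {scalar M} f (GRing.isLinear.Build R M R *%R f lf).

Lemma mk_scalarE M (f : M -> R) (lf : linear (f : M -> R^o)) : mk_scalar lf =1 f.
Proof. by []. Qed.

Lemma scalar_tens_ext M N (f g : {scalar M ⊗ N}) :
  (forall m n, f (m ⊗ₜ n) = g (m ⊗ₜ n)) -> f = g.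
Proof.
by move=> fg; apply: scalar_ext;
  apply: (@tens_linear_eq R M N R^o) => // k x y; exact: linearP.
Qed.

Lemma scalar_tsum L M N (phi : {scalar N}) (f : L -> M -> N) (t : L ⊗ M) :
  phi (tsum f t) = (\sw_(m, n <- t) (phi (f m n) : R^o)).
Proof. by rewrite /tsum /formal_sum linear_sum. Qed.

Lemma scalarZE M (phi : {scalar M}) k x : phi (k *: x) = k * phi x.
Proof. exact: linearZ_LR. Qed.

Lemma lin_scale_form M (k : R) (g : M -> R) :
  linear (g : M -> R^o) -> linear (fun x => k *: (g x : R^o)).
Proof. exact: lin_mulr. Qed.

Lemma lin_tsum_form M N P (f : N -> P -> R) (g : M -> N ⊗ P) :
  is_bilinear (f : N -> P -> R^o) -> linear g ->
  linear (fun x => tsum (f : N -> P -> R^o) (g x)).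
Proof. exact: lin_tsum_arg. Qed.

End Sums.

(* [lin] cannot guess that a codomain written [R] is the module [R^o]. *)
Ltac lin_form_step :=
  first
  [ lin_step
  | match goal with
    | |- @GRing.linear_for _ _ _ _ (fun x => GRing.scale ?k (@?g x)) =>
        refine (@lin_scale_form _ _ _ g _)
    | |- @GRing.linear_for _ _ _ _ (fun x => tsum ?f (@?g x)) =>
        refine (@lin_tsum_form _ _ _ _ f g _ _)
    end ].
Ltac lin ::= repeat lin_form_step.

(** * The flip, forms on B ⊗ B, and the braid map of a form *)

Section Flip.
Variable R : comPzRingType.
Implicit Types M N : lmodType R.

Definition tflip_fun M N (t : M ⊗ N) : N ⊗ M := \sw_(x, y <- t) y ⊗ₜ x.

Lemma tflip_linear M N : linear (@tflip_fun M N).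
Proof. by rewrite /tflip_fun; lin. Qed.

Definition tflip M N : {linear M ⊗ N -> N ⊗ M} := mk_linear (@tflip_linear M N).

Lemma tflipE M N (x : M) (y : N) : tflip M N (x ⊗ₜ y) = y ⊗ₜ x.
Proof. by rewrite /tflip mk_linearE /tflip_fun tsumE //; lin. Qed.

End Flip.

Section Forms.
Variables (R : comPzRingType) (B : bialgebra R).
Implicit Types M N : comodule B.

Lemma cobraiding_ext (σ τ : cobraiding B) :
  (forall a b, σ (a ⊗ₜ b) = τ (a ⊗ₜ b)) -> σ = τ.
Proof.
case: σ τ => [σ p1 p2 p3 p4] [τ q1 q2 q3 q4] /= e.
have {}e : σ = τ.
  exact: scalar_tens_ext.
subst τ; congr Cobraiding; exact: Prop_irrelevance.
Qed.

Definition counit2_fun (t : B ⊗ B) : R^o := tsum (fun b c : B => ε b *: (ε c : R^o)) t.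

Lemma counit2_linear : linear counit2_fun.
Proof. by rewrite /counit2_fun; lin. Qed.

Definition counit2 : {scalar B ⊗ B} := mk_scalar counit2_linear.

Lemma counit2E b c : counit2 (b ⊗ₜ c) = ε b * ε c.
Proof. by rewrite /= /counit2_fun tsumE //; lin. Qed.

Lemma counit_mul t : ε (bmul B t) = counit2 t.
Proof.
have /(congr1 (fun f : {scalar _} => f t)) // :
    mk_scalar (lin_form (bcounit B) (linearP (bmul B))) = counit2.
by apply: scalar_tens_ext => a b; rewrite counit2E -bcounitM.
Qed.

(** The inverse of a braid map receives its two arguments in the opposite order, so a convolution
    inverse enters [braid] through this flipped form. *)
Definition op_form (σ : {scalar B ⊗ B}) : {scalar B ⊗ B} :=
  mk_scalar (lin_form σ (linearP (tflip B B))).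

Lemma op_formE σ b c : op_form σ (b ⊗ₜ c) = σ (c ⊗ₜ b).
Proof. by rewrite -(tflipE b c). Qed.

Lemma convolution_op (σ τ : {scalar B ⊗ B}) a b :
  convolution (op_form σ) (op_form τ) a b = convolution σ τ b a.
Proof.
rewrite /convolution tsum_exchange.
apply: eq_tsum_form => b1 b2; apply: eq_tsum_form => a1 a2.
by rewrite !op_formE.
Qed.

Section Braid.
Variable σ : {scalar B ⊗ B}.

(** No axiom is imposed on σ, so that the formula also serves for convolution inverses and for a
    form extracted from a braiding before it is known to be a cobraiding. *)
Definition braid_fun M N (t : M ⊗ N) : N ⊗ M :=
  \sw_(x, y <- t) \sw_(b, v <- coact M x) \sw_(c, w <- coact N y) σ (b ⊗ₜ c) *: (w ⊗ₜ v).

Lemma braid_linear M N : linear (@braid_fun M N).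
Proof. by rewrite /braid_fun; lin. Qed.

Definition braid M N : {linear M ⊗ N -> N ⊗ M} := mk_linear (@braid_linear M N).

Lemma braidE M N (x : M) (y : N) : braid M N (x ⊗ₜ y) =
  \sw_(b, v <- coact M x) \sw_(c, w <- coact N y) σ (b ⊗ₜ c) *: (w ⊗ₜ v).
Proof. by rewrite /braid mk_linearE /braid_fun tsumE //; lin. Qed.

End Braid.

(** Coassociativity for two comodules at once. Two successive rounds of coaction become
    comultiplications of the legs in B, where identities between elements of B can be applied. *)
Lemma tsum_coactA2 M N (P : lmodType R) (F : B -> B -> M -> B -> B -> N -> P)
    (x : M) (y : N) :
  (forall b v c1 c2 w, linear (fun a => F a b v c1 c2 w)) ->
  (forall b v c1 c2 w, linear (fun a => F b a v c1 c2 w)) ->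
  (forall b1 b2 c1 c2 w, linear (fun a => F b1 b2 a c1 c2 w)) ->
  (forall b1 b2 v c w, linear (fun a => F b1 b2 v a c w)) ->
  (forall b1 b2 v c w, linear (fun a => F b1 b2 v c a w)) ->
  (forall b1 b2 v c1 c2, linear (fun a => F b1 b2 v c1 c2 a)) ->
  \sw_(b, v <- coact M x) \sw_(c, w <- coact N y)
    \sw_(b', v' <- coact M v) \sw_(c', w' <- coact N w) F b b' v' c c' w' =
  \sw_(b, v <- coact M x) \sw_(c, w <- coact N y)
    \sw_(b1, b2 <- δ b) \sw_(c1, c2 <- δ c) F b1 b2 v c1 c2 w.
Proof.
move=> F1 F2 F3 F4 F5 F6.
transitivity (\sw_(b, v <- coact M x) \sw_(b', v' <- coact M v)
    \sw_(c, w <- coact N y) \sw_(c', w' <- coact N w) F b b' v' c c' w').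
  by apply: eq_tsum => b v; rewrite tsum_exchange.
rewrite -(tsum_coactA (F := fun b b' v' => \sw_(c, w <- coact N y)
  \sw_(c', w' <- coact N w) F b b' v' c c' w')); last 3 first.
- move=> b v; do 2 refine (lin_tsum_fun _ _) => ? ?; exact: F1.
- move=> b v; do 2 refine (lin_tsum_fun _ _) => ? ?; exact: F2.
- move=> b v; do 2 refine (lin_tsum_fun _ _) => ? ?; exact: F3.
apply: eq_tsum => b v; rewrite [RHS]tsum_exchange; apply: eq_tsum => b1 b2.
by rewrite -(tsum_coactA (F := fun c c' w' => F b1 b2 v c c' w')).
Qed.

End Forms.

(** * Convolution inverses and inverse operators *)

Section Invertibility.
Variables (R : comPzRingType) (B : bialgebra R).
Implicit Types M N : comodule B.

(** Coassociativity merges the two rounds of coaction, so the coefficient becomes the convolution of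
    σ and τ. This is ε ⊗ ε by hypothesis, and the counit laws of M and N absorb it. *)
Lemma braidK (σ τ : {scalar B ⊗ B}) M N :
  (forall a b : B, convolution σ τ a b = ε a * ε b) ->
  cancel (braid σ M N) (braid (op_form τ) N M).
Proof.
move=> st t; tens_elim t x y; rewrite braidE linear_tsum.
pose F b1 b2 (v : M) c1 c2 (w : N) := (σ (b1 ⊗ₜ c1) * τ (b2 ⊗ₜ c2)) *: (v ⊗ₜ w).
transitivity (\sw_(b, x' <- coact M x) \sw_(c, y' <- coact N y)
    \sw_(b2, v <- coact M x') \sw_(c2, w <- coact N y') F b b2 v c c2 w).
  apply: eq_tsum => b x'; rewrite linear_tsum; apply: eq_tsum => c y'.
  rewrite linZ braidE tsum_exchange scale_tsumr; apply: eq_tsum => b2 v.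
  by rewrite scale_tsumr; apply: eq_tsum => c2 w; rewrite scalerA op_formE.
rewrite (tsum_coactA2 (F := F)); [|by move=> *; rewrite /F; lin..].
rewrite -[in RHS](coact1 x) mk_tsuml; apply: eq_tsum => b v.
rewrite -[in RHS](coact1 y) mk_tsumr; apply: eq_tsum => c w.
rewrite mkZl mkZr scalerA -st /convolution scale_tsuml; apply: eq_tsum => b1 b2.
by rewrite scale_tsuml.
Qed.

Lemma op_formK (σ : {scalar B ⊗ B}) : op_form (op_form σ) = σ.
Proof.
by apply: scalar_tens_ext => b c; rewrite !op_formE.
Qed.

Lemma braidKV (σ τ : {scalar B ⊗ B}) M N :
  (forall a b : B, convolution τ σ a b = ε a * ε b) ->
  cancel (braid (op_form τ) N M) (braid σ M N).
Proof.
move=> ts; rewrite -(op_formK σ); apply: braidK => a b.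
by rewrite convolution_op ts mulrC.
Qed.

Variables (σ : {scalar B ⊗ B}) (S T : {linear B ⊗ B -> B ⊗ B}).
Hypothesis SE : forall b c,
  S (b ⊗ₜ c) = \sw_(b1, b2 <- δ b) \sw_(c1, c2 <- δ c) σ (b1 ⊗ₜ c1) *: (c2 ⊗ₜ b2).
Hypotheses (STK : cancel T S) (TSK : cancel S T).

Lemma tsum_colinear (P : lmodType R) (F : B -> B -> P) b c : is_bilinear F ->
  tsum F (S (b ⊗ₜ c)) =
  \sw_(b1, b2 <- δ b) \sw_(c1, c2 <- δ c) σ (b1 ⊗ₜ c1) *: F c2 b2.
Proof.
move=> bF; rewrite SE tsum_tsum //; apply: eq_tsum => b1 b2.
rewrite tsum_tsum //; apply: eq_tsum => c1 c2.
by rewrite (linear_funZ (tsum_linear bF)) tsumE.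
Qed.

(* [S] commutes with the coactions of the coalgebra B ⊗ B; the first factor is tested
   against [φ]. *)
Lemma colinear_coaction (φ : {scalar B ⊗ B}) t :
  \sw_(c, b <- S t) \sw_(c1, c2 <- δ c) \sw_(b1, b2 <- δ b)
    φ (c1 ⊗ₜ b1) *: (b2 ⊗ₜ c2) =
  \sw_(b, c <- t) \sw_(b1, b2 <- δ b) \sw_(c1, c2 <- δ c)
    φ (S (b1 ⊗ₜ c1)) *: (b2 ⊗ₜ c2).
Proof.
tens_elim t b c; rewrite tsum_colinear; last by lin.
rewrite tsumE; last by lin.
(* Both sides are sums of [F] over threefold coproducts: σ takes the first legs, φ the second, and
   the third remain. Coassociativity is applied to b, then to c. *)
pose F (b1 b2 b3 c1 c2 c3 : B) := σ (b1 ⊗ₜ c1) *: (φ (c2 ⊗ₜ b2) *: (b3 ⊗ₜ c3)).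
transitivity (\sw_(b1, b' <- δ b) \sw_(b2, b3 <- δ b') \sw_(c1, c' <- δ c)
   \sw_(c2, c3 <- δ c') F b1 b2 b3 c1 c2 c3).
  apply: eq_tsum => b1 b'; rewrite [RHS]tsum_exchange; apply: eq_tsum => c1 c'.
  rewrite tsum_exchange scale_tsumr; apply: eq_tsum => b2 b3.
  by rewrite scale_tsumr; apply: eq_tsum => c2 c3.
rewrite -(tsum_comulA (F := fun b1 b2 b3 => \sw_(c1, c' <- δ c)
   \sw_(c2, c3 <- δ c') F b1 b2 b3 c1 c2 c3)); [|by move=> *; rewrite /F; lin..].
apply: eq_tsum => b' b3.
transitivity (\sw_(b1, b2 <- δ b') \sw_(c', c3 <- δ c) \sw_(c1, c2 <- δ c')
  F b1 b2 b3 c1 c2 c3).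
  apply: eq_tsum => b1 b2; apply/esym.
  by rewrite (tsum_comulA (F := fun c1 c2 c3 => F b1 b2 b3 c1 c2 c3)) //;
    move=> *; rewrite /F; lin.
rewrite tsum_exchange; apply: eq_tsum => c' c3.
rewrite SE scalar_tsum scale_tsuml; apply: eq_tsum => b1 b2.
rewrite scalar_tsum scale_tsuml; apply: eq_tsum => c1 c2.
by rewrite scalarZE /F scalerA.
Qed.

(** The counit laws absorb the legs outside σ. Thus a form is recovered from its operator, which is
    one half of each bijection below. *)
Lemma counit2_colinear b c : counit2 B (S (b ⊗ₜ c)) = σ (b ⊗ₜ c).
Proof.
rewrite SE scalar_tsum -[in RHS](bcounitr b) mk_tsuml scalar_tsum.
apply: eq_tsum_form => b1 b2; rewrite scalar_tsum -[in RHS](bcounitr c) mk_tsumr scalar_tsum.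
apply: eq_tsum_form => c1 c2; rewrite mkZl mkZr !scalarZE counit2E.
by rewrite mulrC -mulrA mulrCA.
Qed.

(** The arguments are flipped because S exchanges the two factors and T takes them in the exchanged
    order. *)
Definition convolution_inverse : {scalar B ⊗ B} :=
  mk_scalar (lin_form (counit2 B) (lin_comp T (linearP (tflip B B)))).

Lemma convolution_inverseE b c : convolution_inverse (b ⊗ₜ c) = counit2 B (T (c ⊗ₜ b)).
Proof. by rewrite -(tflipE b c). Qed.

(** The inverse of a colinear map is colinear. In [colinear_coaction], take φ to be (ε ⊗ ε) T and t
    to be T(c ⊗ b). As ST is the identity, one side is the formula wanted; as TS is the identity,
    the coefficient on the other side is ε ⊗ ε, and the counit laws leave T(c ⊗ b). *)
Lemma inverse_colinear c b : T (c ⊗ₜ b) =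
  \sw_(b1, b2 <- δ b) \sw_(c1, c2 <- δ c) convolution_inverse (b1 ⊗ₜ c1) *: (b2 ⊗ₜ c2).
Proof.
have E := colinear_coaction (mk_scalar (lin_form (counit2 B) (linearP T))) (T (c ⊗ₜ b)).
move: E; rewrite STK tsumE; last by lin.
rewrite tsum_exchange => E.
transitivity (\sw_(b0, c0 <- T (c ⊗ₜ b))
     \sw_(b1, b2 <- δ b0) \sw_(c1, c2 <- δ c0)
        counit2 B (T (S (b1 ⊗ₜ c1))) *: (b2 ⊗ₜ c2)).
  rewrite -[LHS]tsum_mk; apply: eq_tsum => b0 c0; apply/esym.
  transitivity (\sw_(b1, b2 <- δ b0) ε b1 *: (b2 ⊗ₜ c0)).
    apply: eq_tsum => b1 b2.
    rewrite -(tsum_counitl (g := fun c => b2 ⊗ₜ c)) ?scale_tsumr; last by lin.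
    by apply: eq_tsum => c1 c2; rewrite TSK counit2E scalerA.
  by rewrite (tsum_counitl (g := fun b => b ⊗ₜ c0)) //; lin.
rewrite -E.
by apply: eq_tsum => b1 b2; apply: eq_tsum => c1 c2; rewrite convolution_inverseE.
Qed.

(** The two convolution identities are the images under ε ⊗ ε of TS = 1 and ST = 1; the second needs
    the expansion of T just proved. The lemma is used both for the braiding of the regular comodule
    and for the core of a skew braiding. *)
Lemma convolution_invertible_bij : convolution_invertible σ.
Proof.
exists convolution_inverse; split=> a b.
  rewrite -counit2E -(TSK (a ⊗ₜ b)) SE linear_tsum scalar_tsum.
  apply: eq_tsum_form => a1 a2; rewrite linear_tsum scalar_tsum; apply: eq_tsum_form => b1 b2.
  by rewrite linZ scalarZE convolution_inverseE.
rewrite -counit2E; transitivity (counit2 B (S (T (b ⊗ₜ a)))); last first.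
  by rewrite STK !counit2E mulrC.
rewrite inverse_colinear linear_tsum scalar_tsum.
apply: eq_tsum_form => a1 a2; rewrite linear_tsum scalar_tsum; apply: eq_tsum_form => b1 b2.
by rewrite linZ scalarZE counit2_colinear.
Qed.

End Invertibility.

(** * Braidings of comodules *)

Section CobraidingToBraiding.
Variables (R : comPzRingType) (B : bialgebra R) (σ : cobraiding B).
Implicit Types M N P : comodule B.

(** Colinearity of the braid map is [cbr_comm], applied to the legs in B once coassociativity has
    brought them together. *)
Lemma braid_coact M N t :
  tens_coact N M (braid σ M N t) = \sw_(b, y <- tens_coact M N t) b ⊗ₜ braid σ M N y.
Proof.
tens_elim t x y; rewrite braidE linear_tsum tsum_tens_coact; last by lin.
(* [F] comes from braiding and then coacting, [G] from coacting and then braiding; they correspond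
   to the two sides of [cbr_comm]. *)
pose F (b1 b2 : B) (v : M) (c1 c2 : B) (w : N) := σ (b1 ⊗ₜ c1) *: ((c2 · b2) ⊗ₜ (w ⊗ₜ v)).
pose G (b1 b2 : B) (v : M) (c1 c2 : B) (w : N) := σ (b2 ⊗ₜ c2) *: ((b1 · c1) ⊗ₜ (w ⊗ₜ v)).
transitivity (\sw_(b, x' <- coact M x) \sw_(c, y' <- coact N y)
    \sw_(b2, v <- coact M x') \sw_(c2, w <- coact N y') F b b2 v c c2 w).
  apply: eq_tsum => b x'; rewrite linear_tsum; apply: eq_tsum => c y'.
  rewrite linZ tens_coactE tsum_exchange scale_tsumr; apply: eq_tsum => b2 v.
  by rewrite scale_tsumr.
rewrite (tsum_coactA2 (F := F)); [|by move=> *; rewrite /F; lin..].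
transitivity (\sw_(b, v <- coact M x) \sw_(c, w <- coact N y)
    \sw_(b1, b2 <- δ b) \sw_(c1, c2 <- δ c) G b1 b2 v c1 c2 w).
  apply: eq_tsum => b v; apply: eq_tsum => c w.
  have := congr1 (fun d => d ⊗ₜ (w ⊗ₜ v)) (cbr_comm σ b c).
  rewrite !mk_tsuml => E; rewrite /F /G.
  transitivity (\sw_(b1, b2 <- δ b)
     ((\sw_(c1, c2 <- δ c) (σ (b1 ⊗ₜ c1) *: (c2 · b2))) ⊗ₜ (w ⊗ₜ v))).
    by apply: eq_tsum => b1 b2; rewrite mk_tsuml; apply: eq_tsum => c1 c2; rewrite mkZl.
  rewrite E; apply: eq_tsum => b1 b2; rewrite mk_tsuml.
  by apply: eq_tsum => c1 c2; rewrite mkZl.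
rewrite -(tsum_coactA2 (F := G)); [|by move=> *; rewrite /G; lin..].
apply: eq_tsum => b x'; apply: eq_tsum => c y'; rewrite braidE mk_tsumr.
by apply: eq_tsum => b2 v; rewrite mk_tsumr; apply: eq_tsum => c2 w; rewrite mkZr.
Qed.

Definition braid_hom M N : comod_hom (tens_comodule M N) (tens_comodule N M) :=
  @ComodHom _ _ (tens_comodule M N) (tens_comodule N M) (braid σ M N) (@braid_coact M N).

Lemma braid_nat M M' N N' (f : comod_hom M M') (g : comod_hom N N') t :
  braid σ M' N' (tmap f g t) = tmap g f (braid σ M N t).
Proof.
tens_elim t x y; rewrite tmapE !braidE (ch_coact f) linear_tsum tsum_tsum; last by lin.
apply: eq_tsum => b v; rewrite linear_tsum tsumE; last by lin.
rewrite (ch_coact g) tsum_tsum; last by lin.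
by apply: eq_tsum => c w; rewrite tsumE ?linZ ?tmapE //; lin.
Qed.

(** Only a linear inverse is asked for: its colinearity is automatic, and the skew braiding reuses
    this inverse as a plain linear map. *)
Lemma braid_bij M N : exists2 g : {linear N ⊗ M -> M ⊗ N},
  cancel (braid σ M N) g & cancel g (braid σ M N).
Proof.
have [τ [st ts]] := cbr_inv σ.
by exists (braid (op_form τ) N M); [apply: braidK | apply: braidKV].
Qed.

Lemma braid_iso M N : is_iso (braid_hom M N : @hom (ComodB B) _ _).
Proof.
have [g fK gK] := braid_bij M N.
exists (ComodHom (comod_inv_coact (f := braid_hom M N) fK gK)).
by split; apply: comod_hom_ext.
Qed.

(** On the right M coacts twice, once against N and once against P. Coassociativity turns this into
    a comultiplication, and the identity becomes [cbr_mulr]. *)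
Lemma braid_hexagon1 M N P t :
  tassoc N P M (braid σ M (tens_comodule N P) (tassoc M N P t)) =
  tmap (lin_idm N) (braid σ M P) (tassoc N M P (tmap (braid σ M N) (lin_idm P) t)).
Proof.
tens_elim t u z; tens_elim u x y.
rewrite tassocE tmapE !braidE mk_tsuml linear_tsum (linear_tsum (tassoc N M P)) (linear_tsum (tmap _ _)).
transitivity (\sw_(b, x' <- coact M x) \sw_(b', v <- coact M x')
   \sw_(c, w <- coact N y) \sw_(d, u <- coact P z)
     (σ (b ⊗ₜ c) * σ (b' ⊗ₜ d)) *: (w ⊗ₜ (u ⊗ₜ v))); last first.
  apply: eq_tsum => b x'; rewrite mk_tsuml (linear_tsum (tassoc N M P)).
  rewrite (linear_tsum (tmap _ _)) tsum_exchange.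
  apply: eq_tsum => c w; rewrite mkZl !linZ tassocE tmapE braidE lin_idmE mk_tsumr.
  rewrite scale_tsumr; apply: eq_tsum => b' v; rewrite mk_tsumr scale_tsumr.
  by apply: eq_tsum => d u; rewrite mkZr scalerA.
rewrite -(tsum_coactA (F := fun b b' v => \sw_(c, w <- coact N y)
   \sw_(d, u <- coact P z) (σ (b ⊗ₜ c) * σ (b' ⊗ₜ d)) *: (w ⊗ₜ (u ⊗ₜ v))));
  [|by move=> *; lin..].
apply: eq_tsum => b v; rewrite linear_tsum.
rewrite [LHS](tsum_tens_coact (M := N) (N := P)
  (F := fun d w => tassoc N P M (σ (b ⊗ₜ d) *: (w ⊗ₜ v)))); last by lin.
rewrite [RHS]tsum_exchange; apply: eq_tsum => c w.
rewrite [RHS]tsum_exchange; apply: eq_tsum => d u.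
rewrite linZ tassocE cbr_mulr scale_tsuml.
by apply: eq_tsum.
Qed.

(** Here P coacts twice, first against N and then against M. This order is the reason for the
    crossed legs in [cbr_mull]. *)
Lemma braid_hexagon2 M N P t :
  tassoc_inv P M N (braid σ (tens_comodule M N) P (tassoc_inv M N P t)) =
  tmap (braid σ M P) (lin_idm N) (tassoc_inv M P N (tmap (lin_idm M) (braid σ N P) t)).
Proof.
tens_elim t x u; tens_elim u y z.
rewrite tassoc_invE tmapE !braidE mk_tsumr linear_tsum.
rewrite (linear_tsum (tassoc_inv M P N)) (linear_tsum (tmap _ _)).
rewrite [LHS](tsum_tens_coact (M := M) (N := N) (F := fun d w =>
  tassoc_inv P M N (\sw_(e, u <- coact P z) σ (d ⊗ₜ e) *: (u ⊗ₜ w)))); last by lin.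
rewrite [LHS]tsum_exchange; apply: eq_tsum => c w.
transitivity (\sw_(d, u <- coact P z) \sw_(d', u' <- coact P u)
  \sw_(b, v <- coact M x) (σ (c ⊗ₜ d) * σ (b ⊗ₜ d')) *: ((u' ⊗ₜ v) ⊗ₜ w)); last first.
  rewrite mk_tsumr (linear_tsum (tassoc_inv M P N)) (linear_tsum (tmap _ _)).
  apply: eq_tsum => d u; rewrite mkZr !linZ tassoc_invE tmapE braidE lin_idmE mk_tsuml.
  rewrite scale_tsumr [LHS]tsum_exchange; apply: eq_tsum => b v.
  rewrite mk_tsuml scale_tsumr.
  by apply: eq_tsum => d' u'; rewrite mkZl scalerA.
rewrite -(tsum_coactA (F := fun d d' u' => \sw_(b, v <- coact M x)
   (σ (c ⊗ₜ d) * σ (b ⊗ₜ d')) *: ((u' ⊗ₜ v) ⊗ₜ w))); [|by move=> *; lin..].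
transitivity (\sw_(d, u <- coact P z) \sw_(b, v <- coact M x)
  σ ((b · c) ⊗ₜ d) *: ((u ⊗ₜ v) ⊗ₜ w)).
  rewrite tsum_exchange; apply: eq_tsum => b v; rewrite linear_tsum.
  by apply: eq_tsum => d u; rewrite linZ tassoc_invE.
apply: eq_tsum => d u; rewrite [RHS]tsum_exchange; apply: eq_tsum => b v.
by rewrite cbr_mull scale_tsuml; apply: eq_tsum => d1 d2; rewrite mulrC.
Qed.

Definition comod_braiding : braiding (ComodB B).
Proof.
refine (@Braiding (ComodB B) braid_hom _ braid_iso _ _).
- move=> M M' N N' f g; apply: comod_hom_ext; exact: (braid_nat f g).
- move=> M N P; apply: comod_hom_ext; exact: (@braid_hexagon1 M N P).
- move=> M N P; apply: comod_hom_ext; exact: (@braid_hexagon2 M N P).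
Defined.

End CobraidingToBraiding.

(** * The regular comodule and cofree comodules *)

Section Cofree.
Variables (R : comPzRingType) (B : bialgebra R).

Definition regular_comodule : comodule B := Comodule (@bcomulA R B) (@bcounitl R B).

Lemma cofree_linear (N : lmodType R) : linear (fun t : B ⊗ N =>
  \sw_(b, x <- t) \sw_(b1, b2 <- δ b) b1 ⊗ₜ (b2 ⊗ₜ x)).
Proof. by lin. Qed.

Definition cofree_coact (N : lmodType R) : {linear B ⊗ N -> B ⊗ (B ⊗ N)} :=
  mk_linear (@cofree_linear N).

Lemma cofree_coactE (N : lmodType R) b (x : N) :
  cofree_coact N (b ⊗ₜ x) = \sw_(b1, b2 <- δ b) b1 ⊗ₜ (b2 ⊗ₜ x).
Proof. by rewrite /cofree_coact mk_linearE tsumE //; lin. Qed.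

Lemma tsum_cofree_coact (N P : lmodType R) (F : B -> B ⊗ N -> P) b (x : N) :
  is_bilinear F -> tsum F (cofree_coact N (b ⊗ₜ x)) = \sw_(b1, b2 <- δ b) F b1 (b2 ⊗ₜ x).
Proof.
move=> bF; rewrite cofree_coactE tsum_tsum //; apply: eq_tsum => b1 b2.
by rewrite tsumE.
Qed.

Lemma cofree_coactA (N : lmodType R) t :
  \sw_(b, y <- cofree_coact N t) \sw_(b1, b2 <- δ b) b1 ⊗ₜ (b2 ⊗ₜ y) =
  \sw_(b, y <- cofree_coact N t) b ⊗ₜ cofree_coact N y.
Proof.
tens_elim t b x; rewrite !tsum_cofree_coact; [|by lin..].
rewrite (tsum_comulA (F := fun b1 b2 b3 => b1 ⊗ₜ (b2 ⊗ₜ (b3 ⊗ₜ x))));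
  [|by move=> *; lin..].
by apply: eq_tsum => b1 b2; rewrite cofree_coactE mk_tsumr.
Qed.

Lemma cofree_coact1 (N : lmodType R) t : \sw_(b, y <- cofree_coact N t) ε b *: y = t.
Proof.
tens_elim t b x; rewrite tsum_cofree_coact; last by lin.
by rewrite (tsum_counitl (g := fun b => b ⊗ₜ x)) //; lin.
Qed.

Definition cofree (N : lmodType R) : comodule B :=
  Comodule (@cofree_coactA N) (@cofree_coact1 N).

Lemma coact_cofree (N : lmodType R) : coact (cofree N) = cofree_coact N.
Proof. by []. Qed.

Definition cofree_counit_fun (N : lmodType R) (t : B ⊗ N) : N := \sw_(b, x <- t) ε b *: x.

Lemma cofree_counit_linear (N : lmodType R) : linear (@cofree_counit_fun N).
Proof. by rewrite /cofree_counit_fun; lin. Qed.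

Definition cofree_counit (N : lmodType R) : {linear B ⊗ N -> N} :=
  mk_linear (@cofree_counit_linear N).

Lemma cofree_counitE (N : lmodType R) b (x : N) : cofree_counit N (b ⊗ₜ x) = ε b *: x.
Proof. by rewrite /cofree_counit mk_linearE /cofree_counit_fun tsumE //; lin. Qed.

Lemma coact_hom_subproof (M : comodule B) x :
  cofree_coact M (coact M x) = \sw_(b, y <- coact M x) b ⊗ₜ coact M y.
Proof. exact: coactA. Qed.

Lemma cofree_counitK (M : comodule B) (x : M) : cofree_counit M (coact M x) = x.
Proof. exact: coact1. Qed.

(** The unit of the adjunction between comodules and modules; its colinearity is coassociativity of
    the coaction. *)
Definition coact_hom (M : comodule B) : comod_hom M (cofree M) :=
  @ComodHom _ _ M (cofree M) (coact M) (@coact_hom_subproof M).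

Lemma point_linear (N : lmodType R) (x : N) : linear (fun b : B => b ⊗ₜ x).
Proof. by lin. Qed.

Lemma point_coact (N : lmodType R) (x : N) b :
  cofree_coact N (mk_linear (point_linear x) b) =
  \sw_(b1, b2 <- δ b) b1 ⊗ₜ mk_linear (point_linear x) b2.
Proof. exact: cofree_coactE. Qed.

Definition point_hom (N : lmodType R) (x : N) : comod_hom regular_comodule (cofree N) :=
  @ComodHom _ _ regular_comodule (cofree N) (mk_linear (point_linear x)) (point_coact x).

(** Multiplicativity of δ makes the product of B a comodule map, so braidings are natural along it.
    This is how the hexagons yield the values of the form on products. *)
Lemma bmul_coact t : δ (bmul B t) =
  \sw_(b, y <- tens_coact regular_comodule regular_comodule t) b ⊗ₜ bmul B y.
Proof.
tens_elim t a b; rewrite bcomulM.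
by rewrite (tsum_tens_coact (M := regular_comodule) (N := regular_comodule)) //; lin.
Qed.

Definition bmul_hom :
    comod_hom (tens_comodule regular_comodule regular_comodule) regular_comodule :=
  @ComodHom _ _ (tens_comodule regular_comodule regular_comodule) regular_comodule
    (bmul B) bmul_coact.

End Cofree.

(** * From braidings of comodules to cobraidings *)

Section BraidingToCobraiding.
Variables (R : comPzRingType) (B : bialgebra R) (β : braiding (ComodB B)).
Implicit Types M N P : comodule B.

Definition br_lin M N : {linear M ⊗ N -> N ⊗ M} := ch_fun (β M N).

Lemma br_lin_nat M M' N N' (f : comod_hom M M') (g : comod_hom N N') t :
  br_lin M' N' (tmap f g t) = tmap g f (br_lin M N t).
Proof. exact: (congr1 (fun h : comod_hom (tens_comodule M N) (tens_comodule N' M') => h t)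
  (br_nat β f g)). Qed.

Let S := br_lin (regular_comodule B) (regular_comodule B).

Definition br_form : {scalar B ⊗ B} := mk_scalar (lin_form (counit2 B) (linearP S)).

Lemma br_formE t : br_form t = counit2 B (S t).
Proof. by []. Qed.

(* Naturality along the coactions [M -> B ⊗ M] reduces [β] to cofree comodules, and
   along the maps [b |-> b ⊗ x] to the regular one. *)
Lemma br_lin_braid M N t : br_lin M N t = braid br_form M N t.
Proof.
tens_elim t x y.
(* The retraction of the coaction is only used as a linear map, so it is inserted after the
   braiding; naturality is used for the colinear coactions alone. *)
have E t : t = tmap (cofree_counit B N) (cofree_counit B M)
    (tmap (coact_hom N) (coact_hom M) t).
  by tens_elim t w v; rewrite !tmapE !cofree_counitK.
rewrite [LHS]E -br_lin_nat tmapE braidE.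
rewrite -[coact_hom M x in LHS]tsum_mk -[coact_hom N y in LHS]tsum_mk mk_tsuml.
rewrite (linear_tsum (br_lin _ _)) (linear_tsum (tmap _ _)).
apply: eq_tsum => b v; rewrite mk_tsumr (linear_tsum (br_lin _ _)) (linear_tsum (tmap _ _)).
apply: eq_tsum => c w.
have -> : (b ⊗ₜ v) ⊗ₜ (c ⊗ₜ w) = tmap (point_hom B v) (point_hom B w) (b ⊗ₜ c).
  by rewrite tmapE.
rewrite br_lin_nat br_formE; move: (br_lin _ _ _) => t.
rewrite -[RHS]/(counit2 B t *: (w ⊗ₜ v)).
tens_elim t c' b'.
by rewrite !tmapE counit2E !cofree_counitE mkZl mkZr scalerA.
Qed.

Lemma br_linE b c :
  S (b ⊗ₜ c) = \sw_(b1, b2 <- δ b) \sw_(c1, c2 <- δ c) br_form (b1 ⊗ₜ c1) *: (c2 ⊗ₜ b2).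
Proof. by rewrite /S br_lin_braid braidE. Qed.

Lemma br_form_invertible : convolution_invertible br_form.
Proof.
pose reg := regular_comodule B.
have [g [gK Kg]] := br_iso β (regular_comodule B) (regular_comodule B).
apply: (convolution_invertible_bij br_linE (T := ch_fun g)) => t.
- exact: (congr1 (fun h : comod_hom (tens_comodule reg reg) (tens_comodule reg reg) => h t) Kg).
- exact: (congr1 (fun h : comod_hom (tens_comodule reg reg) (tens_comodule reg reg) => h t) gK).
Qed.

Lemma collapse_linear :
  linear (fun t : B ⊗ (B ⊗ B) => \sw_(d, u <- t) counit2 B u *: d).
Proof. by lin. Qed.

(** The map B ⊗ ε ⊗ ε, which extracts from a colinearity statement the component in the coacting
    copy of B. *)
Definition collapse : {linear B ⊗ (B ⊗ B) -> B} := mk_linear collapse_linear.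

Lemma collapseE b t : collapse (b ⊗ₜ t) = counit2 B t *: b.
Proof. by rewrite /collapse mk_linearE tsumE //; lin. Qed.

Lemma collapse_coact t :
  collapse (tens_coact (regular_comodule B) (regular_comodule B) t) = bmul B t.
Proof.
tens_elim t c d; rewrite tens_coactE linear_tsum.
rewrite -[in RHS](bcounitr c) mk_tsuml linear_tsum; apply: eq_tsum => c1 c2.
rewrite -[in RHS](bcounitr d) mk_tsumr !linear_tsum; apply: eq_tsum => d1 d2.
rewrite collapseE counit2E mkZl mkZr.
by rewrite !(linZ (bmul B)) scalerA.
Qed.

(** Apply [collapse] to the colinearity of S: coacting after S gives the product of the factors of
    S(a ⊗ b), and coacting before S leaves the form on the second legs. *)
Lemma br_form_comm a b :
    \sw_(a1, a2 <- δ a) \sw_(b1, b2 <- δ b) br_form (a1 ⊗ₜ b1) *: (b2 · a2) =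
    \sw_(a1, a2 <- δ a) \sw_(b1, b2 <- δ b) br_form (a2 ⊗ₜ b2) *: (a1 · b1).
Proof.
pose reg := regular_comodule B.
have E : tens_coact reg reg (S (a ⊗ₜ b)) =
    \sw_(d, u <- tens_coact reg reg (a ⊗ₜ b)) d ⊗ₜ S u := ch_coact (β reg reg) (a ⊗ₜ b).
move/(congr1 collapse): E; rewrite collapse_coact br_linE.
rewrite (tsum_tens_coact (F := fun b y => b ⊗ₜ S y)); last by lin.
rewrite !linear_tsum => E; apply: etrans (etrans E _).
  apply: eq_tsum => a1 a2; rewrite linear_tsum; apply: eq_tsum => b1 b2.
  by rewrite linZ.
apply: eq_tsum => a1 a2; rewrite linear_tsum; apply: eq_tsum => b1 b2.
by rewrite collapseE.
Qed.

(** This is ε ⊗ ε ⊗ ε: since ε is multiplicative, the last two factors may be multiplied first. *)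
Definition counit3 : {scalar B ⊗ (B ⊗ B)} :=
  mk_scalar (lin_form (counit2 B) (linearP (tmap (lin_idm B) (bmul B)))).

Lemma counit3E b t : counit3 (b ⊗ₜ t) = ε b * counit2 B t.
Proof.
have E : counit3 (b ⊗ₜ t) = counit2 B (b ⊗ₜ bmul B t) by rewrite -(tmapE (lin_idm B)).
by rewrite E counit2E counit_mul.
Qed.

Lemma counit3_assoc t b : counit3 (tassoc B B B (t ⊗ₜ b)) = counit2 B t * ε b.
Proof.
have E : mk_scalar (lin_form counit3 (lin_comp (tassoc B B B)
      ((tens_mk_bilinear (B ⊗ B) B).1 b))) = mk_scalar (lin_mull (ε b) (linearP (counit2 B))).
  by apply: scalar_tens_ext => c d; rewrite [LHS]mk_scalarE [RHS]mk_scalarE tassocE counit3E !counit2E mulrA.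
exact: (congr1 (fun f : {scalar B ⊗ B} => f t) E).
Qed.

Lemma counit3_tassoc t : counit3 (tassoc B B B t) = counit2 B (tmap (bmul B) (lin_idm B) t).
Proof.
have E : mk_scalar (lin_form counit3 (linearP (tassoc B B B))) =
    mk_scalar (lin_form (counit2 B) (linearP (tmap (bmul B) (lin_idm B)))).
  by apply: scalar_tens_ext => u b;
    rewrite [LHS]mk_scalarE [RHS]mk_scalarE counit3_assoc tmapE counit2E counit_mul.
exact: (congr1 (fun f : {scalar (B ⊗ B) ⊗ B} => f t) E).
Qed.

(** The image under ε ⊗ ε ⊗ ε of the first hexagon for the regular comodule. Two factors of the left
    side are multiplied before the counits apply, and naturality along the product moves this
    multiplication inside S. *)
Lemma br_form_mulr a b c :
  br_form (a ⊗ₜ (b · c)) =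
  \sw_(a1, a2 <- δ a) (br_form (a1 ⊗ₜ b) * br_form (a2 ⊗ₜ c) : R^o).
Proof.
pose reg := regular_comodule B; pose reg2 := tens_comodule reg reg.
have H : tassoc B B B (br_lin reg reg2 (tassoc B B B ((a ⊗ₜ b) ⊗ₜ c))) =
    tmap (lin_idm B) S (tassoc B B B (tmap S (lin_idm B) ((a ⊗ₜ b) ⊗ₜ c))) :=
  congr1 (fun h : comod_hom (tens_comodule reg2 reg) (tens_comodule reg reg2) =>
    h ((a ⊗ₜ b) ⊗ₜ c)) (br_hexagon1 β reg reg reg).
move/(congr1 counit3): H; rewrite counit3_tassoc tassocE tmapE.
have -> : tmap (bmul B) (lin_idm B) (br_lin reg reg2 (a ⊗ₜ (b ⊗ₜ c))) = S (a ⊗ₜ (b · c)).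
  by rewrite -(br_lin_nat (comod_idm reg) (bmul_hom B)) tmapE.
rewrite (br_linE a b) mk_tsuml (linear_tsum (tassoc B B B)) (linear_tsum (tmap _ _)) scalar_tsum.
move=> H; apply: etrans H _.
apply: eq_tsum_form => a1 a2.
rewrite mk_tsuml (linear_tsum (tassoc B B B)) (linear_tsum (tmap _ _)) scalar_tsum.
rewrite -[in RHS](bcounitr b) mk_tsumr scalar_tsum mul_tsuml.
apply: eq_tsum_form => b1 b2.
rewrite mkZl mkZr (linZ (tassoc B B B)) (linZ (tmap _ _)) !scalarZE tassocE tmapE counit3E.
by rewrite mulrCA mulrA.
Qed.

Lemma br_form_mull a b c :
  br_form ((a · b) ⊗ₜ c) =
  \sw_(c1, c2 <- δ c) (br_form (a ⊗ₜ c2) * br_form (b ⊗ₜ c1) : R^o).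
Proof.
pose reg := regular_comodule B; pose reg2 := tens_comodule reg reg.
have H : tassoc_inv B B B (br_lin reg2 reg (tassoc_inv B B B (a ⊗ₜ (b ⊗ₜ c)))) =
    tmap S (lin_idm B) (tassoc_inv B B B (tmap (lin_idm B) S (a ⊗ₜ (b ⊗ₜ c)))) :=
  congr1 (fun h : comod_hom (tens_comodule reg reg2) (tens_comodule reg2 reg) =>
    h (a ⊗ₜ (b ⊗ₜ c))) (br_hexagon2 β reg reg reg).
(* Both sides of the second hexagon are bracketed to the left; reassociating makes [counit3]
   applicable and cancels the outer inverse associator on the left side. *)
move/(congr1 (fun t => counit3 (tassoc B B B t))): H.
rewrite tassoc_invK tassoc_invE tmapE.
have -> : counit3 (br_lin reg2 reg ((a ⊗ₜ b) ⊗ₜ c)) = br_form ((a · b) ⊗ₜ c).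
  have := br_lin_nat (bmul_hom B) (comod_idm reg) ((a ⊗ₜ b) ⊗ₜ c).
  by rewrite tmapE => /(congr1 (counit2 B)) /esym.
rewrite (br_linE b c) tsum_exchange mk_tsumr (linear_tsum (tassoc_inv B B B)).
rewrite (linear_tsum (tmap _ _)) (linear_tsum (tassoc B B B)) scalar_tsum.
move=> H; apply: etrans H _.
apply: eq_tsum_form => c1 c2.
rewrite mk_tsumr (linear_tsum (tassoc_inv B B B)) (linear_tsum (tmap _ _)).
rewrite (linear_tsum (tassoc B B B)) scalar_tsum.
rewrite -[in RHS](bcounitr b) mulrC mk_tsuml scalar_tsum mul_tsuml.
apply: eq_tsum_form => b1 b2.
rewrite mkZl mkZr (linZ (tassoc_inv B B B)) (linZ (tmap _ _)) (linZ (tassoc B B B)).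
rewrite !scalarZE tassoc_invE tmapE counit3_assoc.
rewrite [X in _ * X]mulrC mulrCA [RHS]mulrAC -[RHS]mulrA; congr (_ * _); exact: mulrC.
Qed.

Definition br_cobraiding : cobraiding B :=
  Cobraiding br_form_invertible br_form_comm br_form_mull br_form_mulr.

End BraidingToCobraiding.

(** * The bijection between cobraidings and braidings of comodules *)

Section ComodBijection.
Variables (R : comPzRingType) (B : bialgebra R).

Lemma braiding_ext (β γ : braiding (ComodB B)) :
  (forall M N t, br_lin β M N t = br_lin γ M N t) -> β = γ.
Proof.
case: β γ => [β p1 p2 p3 p4] [γ q1 q2 q3 q4] /= e.
have {}e : β = γ.
  apply: functional_extensionality_dep => M; apply: functional_extensionality_dep => N.
  exact: (@comod_hom_ext R B (tens_comodule M N) (tens_comodule N M) _ _ (e M N)).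
subst γ; congr Braiding; exact: Prop_irrelevance.
Qed.

Lemma br_cobraidingK : cancel (@br_cobraiding R B) (@comod_braiding R B).
Proof. by move=> β; apply: braiding_ext => M N t; exact: esym (br_lin_braid β t). Qed.

Lemma comod_braidingK : cancel (@comod_braiding R B) (@br_cobraiding R B).
Proof.
move=> σ; apply: cobraiding_ext => b c.
by apply: (counit2_colinear (S := braid σ (regular_comodule B) (regular_comodule B))) => *;
  rewrite braidE.
Qed.

End ComodBijection.

(** * Skew braidings *)

Ltac unfold_RModB :=
  cbv beta iota delta [comp tmor tobj idm hom obj tc_cat sm_cat sm_a RModB RModB_tensor RMod].

Section CompExt.
Variables (R : comPzRingType) (M N N' P P' Q : lmodType R).
Variables (g1 : {linear P' -> Q}) (g2 : {linear N' -> P'}) (g3 : {linear M -> N'}).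

Lemma lin_comp23_ext (f1 : {linear P -> Q}) (f2 : {linear M -> P}) :
  (forall t, f1 (f2 t) = g1 (g2 (g3 t))) ->
  lin_compm f1 f2 = lin_compm (lin_compm g1 g2) g3.
Proof. by move=> E; apply: linear_ext. Qed.

Lemma lin_comp33_ext (f1 : {linear P -> Q}) (f2 : {linear N -> P}) (f3 : {linear M -> N}) :
  (forall t, f1 (f2 (f3 t)) = g1 (g2 (g3 t))) ->
  lin_compm (lin_compm f1 f2) f3 = lin_compm (lin_compm g1 g2) g3.
Proof. by move=> E; apply: linear_ext. Qed.

End CompExt.

(** * From cobraidings to skew braidings *)

Section CobraidingToSkew.
Variables (R : comPzRingType) (B : bialgebra R) (σ : cobraiding B).
Implicit Types X Y A C D : lmodType R.

Definition skew_braid X A C : {linear star B (star B X A) C -> star B (star B X C) A} :=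
  lin_compm (tassoc_inv X (B ⊗ C) (B ⊗ A))
    (lin_compm (tmap (lin_idm X) (braid σ (cofree B A) (cofree B C)))
       (tassoc X (B ⊗ A) (B ⊗ C))).

Lemma skew_braidE X A C x b a c y :
  skew_braid X A C ((x ⊗ₜ (b ⊗ₜ a)) ⊗ₜ (c ⊗ₜ y)) =
  \sw_(b1, b2 <- δ b) \sw_(c1, c2 <- δ c)
    σ (b1 ⊗ₜ c1) *: ((x ⊗ₜ (c2 ⊗ₜ y)) ⊗ₜ (b2 ⊗ₜ a)).
Proof.
rewrite /skew_braid !lin_compmE tassocE tmapE braidE !coact_cofree.
rewrite tsum_cofree_coact; last by lin.
rewrite lin_idmE mk_tsumr linear_tsum; apply: eq_tsum => b1 b2.
rewrite tsum_cofree_coact; last by lin.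
rewrite mk_tsumr linear_tsum; apply: eq_tsum => c1 c2.
by rewrite mkZr linZ tassoc_invE.
Qed.

Lemma skew_braid_nat X X' A A' C C' (f : {linear X -> X'}) (g : {linear A -> A'})
    (h : {linear C -> C'}) t :
  skew_braid X' A' C' (starm B (starm B f g) h t) =
  starm B (starm B f h) g (skew_braid X A C t).
Proof.
tens_elim t u v; tens_elim u x p; tens_elim p b a; tens_elim v c y.
rewrite !starmE !skew_braidE (linear_tsum (starm _ _ _)); apply: eq_tsum => b1 b2.
rewrite (linear_tsum (starm _ _ _)); apply: eq_tsum => c1 c2.
by rewrite (linZ (starm _ _ _)) !starmE.
Qed.

Lemma skew_braid_bij X A C :
  exists2 g : {linear star B (star B X C) A -> star B (star B X A) C},
  cancel (skew_braid X A C) g & cancel g (skew_braid X A C).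
Proof.
have [g fK gK] := braid_bij σ (cofree B A) (cofree B C).
exists (lin_compm (tassoc_inv X (B ⊗ A) (B ⊗ C))
    (lin_compm (tmap (lin_idm X) g) (tassoc X (B ⊗ C) (B ⊗ A)))) => t;
  rewrite /skew_braid !lin_compmE tassoc_invK.
- rewrite -[RHS]tassocK; congr (tassoc_inv _ _ _ _).
  by move: (tassoc _ _ _ t) => u; tens_elim u x v; rewrite !tmapE fK.
- rewrite -[RHS]tassocK; congr (tassoc_inv _ _ _ _).
  by move: (tassoc _ _ _ t) => u; tens_elim u x v; rewrite !tmapE gK.
Qed.

(** Apply σ(-, d) to both sides of [cbr_comm] for b and c, and expand the products by [cbr_mull]. *)
Lemma cobraiding_yang_baxter b c d :
  \sw_(b1, b2 <- δ b) \sw_(c1, c2 <- δ c) \sw_(d1, d2 <- δ d)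
    (σ (c1 ⊗ₜ d1) * σ (b1 ⊗ₜ d2) * σ (b2 ⊗ₜ c2) : R^o) =
  \sw_(b1, b2 <- δ b) \sw_(c1, c2 <- δ c) \sw_(d1, d2 <- δ d)
    (σ (b1 ⊗ₜ c1) * σ (b2 ⊗ₜ d1) * σ (c2 ⊗ₜ d2) : R^o).
Proof.
have := congr1 (fun t => σ (t ⊗ₜ d)) (cbr_comm σ b c).
rewrite !mk_tsuml !scalar_tsum => E; apply: etrans (etrans (esym E) _).
  apply: eq_tsum_form => b1 b2; rewrite mk_tsuml scalar_tsum.
  apply: eq_tsum_form => c1 c2; rewrite mkZl scalarZE cbr_mull mulrC mul_tsuml.
  by apply: eq_tsum_form => d1 d2; rewrite [X in X * _]mulrC.
apply: eq_tsum_form => b1 b2; rewrite mk_tsuml scalar_tsum.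
apply: eq_tsum_form => c1 c2; rewrite mkZl scalarZE cbr_mull mulrC mul_tsuml.
by apply: eq_tsum_form => d1 d2; rewrite mulrC mulrA mulrAC.
Qed.

Definition trilinear (P : lmodType R) (F : B -> B -> B -> P) : Prop :=
  (forall y z, linear (fun x => F x y z)) /\ (forall x z, linear (fun y => F x y z)) /\
  (forall x y, linear (fun z => F x y z)).

(** Coassociativity in three variables at once. The third legs move to the outer sums, so that an
    identity in the first two legs can be applied inside. *)
Lemma tsum_comulA3 (P : lmodType R) (F : B -> B -> B -> B -> B -> B -> B -> B -> B -> P) b c d :
  (forall c1 c2 c3 d1 d2 d3, trilinear (fun b1 b2 b3 => F b1 b2 b3 c1 c2 c3 d1 d2 d3)) ->
  (forall b1 b2 b3 d1 d2 d3, trilinear (fun c1 c2 c3 => F b1 b2 b3 c1 c2 c3 d1 d2 d3)) ->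
  (forall b1 b2 b3 c1 c2 c3, trilinear (fun d1 d2 d3 => F b1 b2 b3 c1 c2 c3 d1 d2 d3)) ->
  \sw_(b1, b' <- δ b) \sw_(b2, b3 <- δ b') \sw_(c1, c' <- δ c) \sw_(c2, c3 <- δ c')
    \sw_(d1, d' <- δ d) \sw_(d2, d3 <- δ d') F b1 b2 b3 c1 c2 c3 d1 d2 d3 =
  \sw_(b', b3 <- δ b) \sw_(c', c3 <- δ c) \sw_(d', d3 <- δ d)
    \sw_(b1, b2 <- δ b') \sw_(c1, c2 <- δ c') \sw_(d1, d2 <- δ d')
      F b1 b2 b3 c1 c2 c3 d1 d2 d3.
Proof.
move=> Fb Fc Fd.
rewrite -(tsum_comulA (F := fun b1 b2 b3 => \sw_(c1, c' <- δ c) \sw_(c2, c3 <- δ c')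
    \sw_(d1, d' <- δ d) \sw_(d2, d3 <- δ d') F b1 b2 b3 c1 c2 c3 d1 d2 d3)); last 3 first.
- move=> y z; do 4 refine (lin_tsum_fun _ _) => ? ?; exact: (Fb _ _ _ _ _ _).1.
- move=> y z; do 4 refine (lin_tsum_fun _ _) => ? ?; exact: (Fb _ _ _ _ _ _).2.1.
- move=> y z; do 4 refine (lin_tsum_fun _ _) => ? ?; exact: (Fb _ _ _ _ _ _).2.2.
apply: eq_tsum => b' b3.
transitivity (\sw_(b1, b2 <- δ b') \sw_(c', c3 <- δ c) \sw_(c1, c2 <- δ c')
    \sw_(d', d3 <- δ d) \sw_(d1, d2 <- δ d') F b1 b2 b3 c1 c2 c3 d1 d2 d3).
  apply: eq_tsum => b1 b2.
  rewrite -(tsum_comulA (F := fun c1 c2 c3 =>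
    \sw_(d1, d' <- δ d) \sw_(d2, d3 <- δ d') F b1 b2 b3 c1 c2 c3 d1 d2 d3)); last 3 first.
  - move=> y z; do 2 refine (lin_tsum_fun _ _) => ? ?; exact: (Fc _ _ _ _ _ _).1.
  - move=> y z; do 2 refine (lin_tsum_fun _ _) => ? ?; exact: (Fc _ _ _ _ _ _).2.1.
  - move=> y z; do 2 refine (lin_tsum_fun _ _) => ? ?; exact: (Fc _ _ _ _ _ _).2.2.
  do 2 apply: eq_tsum => ? ?; apply/esym.
  apply: tsum_comulA => y z; last exact: (Fd _ _ _ _ _ _).2.2.
    exact: (Fd _ _ _ _ _ _).1.
  exact: (Fd _ _ _ _ _ _).2.1.
rewrite tsum_exchange; apply: eq_tsum => c' c3.
transitivity (\sw_(b1, b2 <- δ b') \sw_(d', d3 <- δ d) \sw_(c1, c2 <- δ c')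
     \sw_(d1, d2 <- δ d') F b1 b2 b3 c1 c2 c3 d1 d2 d3).
  by apply: eq_tsum => b1 b2; rewrite tsum_exchange.
by rewrite tsum_exchange.
Qed.

(* The braid relation for [b ⊗ c |-> Σ σ(b1, c1) c2 ⊗ b2], tested against [V]. *)
Lemma tsum_yang_baxter (P : lmodType R) (V : B -> B -> B -> P) b c d : trilinear V ->
  \sw_(c1, c' <- δ c) \sw_(d1, d' <- δ d) (σ (c1 ⊗ₜ d1) *:
    (\sw_(b1, b' <- δ b) \sw_(d2, d3 <- δ d') (σ (b1 ⊗ₜ d2) *:
      (\sw_(b2, b3 <- δ b') \sw_(c2, c3 <- δ c') (σ (b2 ⊗ₜ c2) *: V b3 c3 d3))))) =
  \sw_(b1, b' <- δ b) \sw_(c1, c' <- δ c) (σ (b1 ⊗ₜ c1) *: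
    (\sw_(b2, b3 <- δ b') \sw_(d1, d' <- δ d) (σ (b2 ⊗ₜ d1) *:
      (\sw_(c2, c3 <- δ c') \sw_(d2, d3 <- δ d') (σ (c2 ⊗ₜ d2) *: V b3 c3 d3))))).
Proof.
move=> [V1 [V2 V3]].
pose F b1 b2 b3 c1 c2 c3 d1 d2 d3 :=
  (σ (c1 ⊗ₜ d1) * σ (b1 ⊗ₜ d2) * σ (b2 ⊗ₜ c2)) *: V b3 c3 d3.
pose G b1 b2 b3 c1 c2 c3 d1 d2 d3 :=
  (σ (b1 ⊗ₜ c1) * σ (b2 ⊗ₜ d1) * σ (c2 ⊗ₜ d2)) *: V b3 c3 d3.
transitivity (\sw_(b1, b' <- δ b) \sw_(b2, b3 <- δ b') \sw_(c1, c' <- δ c)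
   \sw_(c2, c3 <- δ c') \sw_(d1, d' <- δ d) \sw_(d2, d3 <- δ d')
     F b1 b2 b3 c1 c2 c3 d1 d2 d3).
  transitivity (\sw_(c1, c' <- δ c) \sw_(b1, b' <- δ b) \sw_(b2, b3 <- δ b')
     \sw_(c2, c3 <- δ c') \sw_(d1, d' <- δ d) \sw_(d2, d3 <- δ d')
       F b1 b2 b3 c1 c2 c3 d1 d2 d3); last first.
    by rewrite tsum_exchange; apply: eq_tsum => b1 b'; rewrite tsum_exchange.
  apply: eq_tsum => c1 c'.
  transitivity (\sw_(d1, d' <- δ d) \sw_(b1, b' <- δ b) \sw_(b2, b3 <- δ b')
     \sw_(c2, c3 <- δ c') \sw_(d2, d3 <- δ d') F b1 b2 b3 c1 c2 c3 d1 d2 d3).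
    apply: eq_tsum => d1 d'; rewrite scale_tsumr; apply: eq_tsum => b1 b'.
    rewrite scale_tsumr.
    transitivity (\sw_(d2, d3 <- δ d') \sw_(b2, b3 <- δ b') \sw_(c2, c3 <- δ c')
       F b1 b2 b3 c1 c2 c3 d1 d2 d3).
      apply: eq_tsum => d2 d3; rewrite !scale_tsumr; apply: eq_tsum => b2 b3.
      by rewrite !scale_tsumr; apply: eq_tsum => c2 c3; rewrite !scalerA.
    by rewrite tsum_exchange; apply: eq_tsum => b2 b3; rewrite tsum_exchange.
  rewrite tsum_exchange; apply: eq_tsum => b1 b'.
  by rewrite tsum_exchange; apply: eq_tsum => b2 b3; rewrite tsum_exchange.
transitivity (\sw_(b1, b' <- δ b) \sw_(b2, b3 <- δ b') \sw_(c1, c' <- δ c)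
   \sw_(c2, c3 <- δ c') \sw_(d1, d' <- δ d) \sw_(d2, d3 <- δ d')
     G b1 b2 b3 c1 c2 c3 d1 d2 d3); last first.
  apply: eq_tsum => b1 b'; rewrite tsum_exchange; apply: eq_tsum => c1 c'.
  rewrite scale_tsumr; apply: eq_tsum => b2 b3.
  rewrite scale_tsumr tsum_exchange; apply: eq_tsum => d1 d'.
  rewrite !scale_tsumr; apply: eq_tsum => c2 c3.
  by rewrite !scale_tsumr; apply: eq_tsum => d2 d3; rewrite !scalerA.
rewrite (tsum_comulA3 (F := F)); [|by move=> *; split; [|split]=> *; rewrite /F; lin..].
rewrite (tsum_comulA3 (F := G)); [|by move=> *; split; [|split]=> *; rewrite /G; lin..].
apply: eq_tsum => b' b3; apply: eq_tsum => c' c3; apply: eq_tsum => d' d3.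
(* With the third legs fixed, both sides are multiples of one vector, and the coefficients agree by
   the Yang-Baxter identity. *)
have := congr1 (fun k => k *: V b3 c3 d3) (cobraiding_yang_baxter b' c' d').
rewrite !scale_tsuml => E; apply: etrans (etrans E _).
  apply: eq_tsum => b1 b2; rewrite scale_tsuml; apply: eq_tsum => c1 c2.
  by rewrite scale_tsuml.
apply: eq_tsum => b1 b2; rewrite scale_tsuml; apply: eq_tsum => c1 c2.
by rewrite scale_tsuml.
Qed.

Lemma skew_braid_B1 X A C D t :
  skew_braid (star B X D) A C (starm B (skew_braid X A D) (lin_idm C)
    (skew_braid (star B X A) C D t)) =
  starm B (skew_braid X C D) (lin_idm A) (skew_braid (star B X C) A D
    (starm B (skew_braid X A C) (lin_idm D) t)).
Proof.
tens_elim t u v; tens_elim v d z; tens_elim u w q; tens_elim q c y.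
tens_elim w x p; tens_elim p b a.
rewrite starmE !skew_braidE lin_idmE mk_tsuml.
rewrite (linear_tsum (starm _ _ _)) (linear_tsum (skew_braid _ A C)).
rewrite (linear_tsum (skew_braid _ A D)) (linear_tsum (starm _ _ _)).
(* The elements of X, A, C and D are only carried along; [V] records where the last legs of b, c and
   d end up. *)
pose V (b c d : B) := ((x ⊗ₜ (d ⊗ₜ z)) ⊗ₜ (c ⊗ₜ y)) ⊗ₜ (b ⊗ₜ a).
have V3 : trilinear V by split; [|split]=> *; rewrite /V; lin.
apply: etrans (etrans (tsum_yang_baxter b c d V3) _).
  apply: eq_tsum => c1 c'.
  rewrite (linear_tsum (starm _ _ _)) (linear_tsum (skew_braid _ A C)).
  apply: eq_tsum => d1 d'.
  rewrite (linZ (starm _ _ _)) (linZ (skew_braid _ A C)); congr (_ *: _).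
  rewrite starmE skew_braidE lin_idmE mk_tsuml (linear_tsum (skew_braid _ A C)).
  apply: eq_tsum => b1 b'; rewrite mk_tsuml (linear_tsum (skew_braid _ A C)).
  apply: eq_tsum => d2 d3; rewrite mkZl (linZ (skew_braid _ A C)); congr (_ *: _).
  by rewrite skew_braidE.
apply: eq_tsum => b1 b'; rewrite mk_tsuml.
rewrite (linear_tsum (skew_braid _ A D)) (linear_tsum (starm _ _ _)).
apply: eq_tsum => c1 c'; rewrite mkZl.
rewrite (linZ (skew_braid _ A D)) (linZ (starm _ _ _)); congr (_ *: _).
rewrite skew_braidE (linear_tsum (starm _ _ _)).
apply: eq_tsum => b2 b3; rewrite (linear_tsum (starm _ _ _)).
apply: eq_tsum => d1 d'; rewrite (linZ (starm _ _ _)); congr (_ *: _).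
rewrite starmE skew_braidE lin_idmE mk_tsuml.
apply: eq_tsum => c2 c3; rewrite mk_tsuml; apply: eq_tsum => d2 d3.
by rewrite mkZl.
Qed.

(** The associator feeds the product of c and a leg of d into σ, so [cbr_mulr] applies;
    coassociativity for b and d then matches the two sides. *)
Lemma skew_braid_B2 X A C D t :
  skew_braid X A (star B C D) (star_assoc B (star B X A) C D t) =
  starm B (star_assoc B X C D) (lin_idm A) (skew_braid (star B X C) A D
    (starm B (skew_braid X A C) (lin_idm D) t)).
Proof.
tens_elim t u v; tens_elim v d z; tens_elim u w q; tens_elim q c y.
tens_elim w x p; tens_elim p b a.
rewrite starmE star_assocE skew_braidE lin_idmE mk_tsuml.
rewrite (linear_tsum (skew_braid _ A (star B C D))).
rewrite (linear_tsum (skew_braid _ A D)) (linear_tsum (starm _ _ _)).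
pose F (b1 b2 b3 c1 c2 d1 d2 d3 : B) := (σ (b1 ⊗ₜ c1) * σ (b2 ⊗ₜ d1)) *:
  ((x ⊗ₜ ((c2 · d2) ⊗ₜ (y ⊗ₜ (d3 ⊗ₜ z)))) ⊗ₜ (b3 ⊗ₜ a)).
transitivity (\sw_(b', b3 <- δ b) \sw_(c1, c2 <- δ c) \sw_(d', d3 <- δ d)
   \sw_(b1, b2 <- δ b') \sw_(d1, d2 <- δ d') F b1 b2 b3 c1 c2 d1 d2 d3).
  transitivity (\sw_(d', d3 <- δ d) \sw_(b', b3 <- δ b) \sw_(c1, c2 <- δ c)
    \sw_(b1, b2 <- δ b') \sw_(d1, d2 <- δ d') F b1 b2 b3 c1 c2 d1 d2 d3).
    apply: eq_tsum => d' d3; rewrite skew_braidE; apply: eq_tsum => b' b3.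
    rewrite tsum_comulM; last by lin.
    apply: eq_tsum => c1 c2; rewrite [RHS]tsum_exchange; apply: eq_tsum => d1 d2.
    by rewrite cbr_mulr scale_tsuml.
  by rewrite tsum_exchange; apply: eq_tsum => b' b3; rewrite tsum_exchange.
transitivity (\sw_(b', b3 <- δ b) \sw_(b1, b2 <- δ b') \sw_(c1, c2 <- δ c)
   \sw_(d', d3 <- δ d) \sw_(d1, d2 <- δ d') F b1 b2 b3 c1 c2 d1 d2 d3).
  apply: eq_tsum => b' b3; rewrite [RHS]tsum_exchange; apply: eq_tsum => c1 c2.
  by rewrite tsum_exchange.
rewrite (tsum_comulA (F := fun b1 b2 b3 => \sw_(c1, c2 <- δ c)
   \sw_(d', d3 <- δ d) \sw_(d1, d2 <- δ d') F b1 b2 b3 c1 c2 d1 d2 d3));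
  [|by move=> *; rewrite /F; lin..].
apply: eq_tsum => b1 b'; rewrite tsum_exchange mk_tsuml.
rewrite (linear_tsum (skew_braid _ A D)) (linear_tsum (starm _ _ _)).
apply: eq_tsum => c1 c2; rewrite mkZl.
rewrite (linZ (skew_braid _ A D)) (linZ (starm _ _ _)).
rewrite skew_braidE (linear_tsum (starm _ _ _)) scale_tsumr.
apply: eq_tsum => b2 b3; rewrite (linear_tsum (starm _ _ _)) scale_tsumr.
rewrite (tsum_comulA (F := fun d1 d2 d3 => F b1 b2 b3 c1 c2 d1 d2 d3));
  [|by move=> *; rewrite /F; lin..].
apply: eq_tsum => d1 d'; rewrite (linZ (starm _ _ _)) scalerA.
rewrite starmE star_assocE lin_idmE mk_tsuml scale_tsumr.
by apply: eq_tsum.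
Qed.

(** Dual to (B2): the product now stands in the first argument of σ, [cbr_mull] expands it, and
    coassociativity is used for c and d. *)
Lemma skew_braid_B3 X A C D t :
  skew_braid X (star B A C) D (starm B (star_assoc B X A C) (lin_idm D) t) =
  star_assoc B (star B X D) A C (starm B (skew_braid X A D) (lin_idm C)
    (skew_braid (star B X A) C D t)).
Proof.
tens_elim t u v; tens_elim v d z; tens_elim u w q; tens_elim q c y.
tens_elim w x p; tens_elim p b a.
rewrite starmE star_assocE skew_braidE lin_idmE mk_tsuml.
rewrite (linear_tsum (skew_braid _ _ D)).
rewrite (linear_tsum (starm _ _ _)) (linear_tsum (star_assoc _ _ _ _)).
pose F (b1 b2 c1 c2 c3 d1 d2 d3 : B) := (σ (c1 ⊗ₜ d1) * σ (b1 ⊗ₜ d2)) *: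
  ((x ⊗ₜ (d3 ⊗ₜ z)) ⊗ₜ ((b2 · c2) ⊗ₜ (a ⊗ₜ (c3 ⊗ₜ y)))).
transitivity (\sw_(c', c3 <- δ c) \sw_(c1, c2 <- δ c') \sw_(b1, b2 <- δ b)
   \sw_(d', d3 <- δ d) \sw_(d1, d2 <- δ d') F b1 b2 c1 c2 c3 d1 d2 d3).
  apply: eq_tsum => c' c3; rewrite skew_braidE tsum_comulM; last by lin.
  rewrite tsum_exchange; apply: eq_tsum => c1 c2; apply: eq_tsum => b1 b2.
  apply: eq_tsum => d' d3; rewrite cbr_mull scale_tsuml.
  by apply: eq_tsum => d1 d2; rewrite mulrC.
rewrite (tsum_comulA (F := fun c1 c2 c3 => \sw_(b1, b2 <- δ b)
   \sw_(d', d3 <- δ d) \sw_(d1, d2 <- δ d') F b1 b2 c1 c2 c3 d1 d2 d3));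
  [|by move=> *; rewrite /F; lin..].
apply: eq_tsum => c1 c'.
rewrite (linear_tsum (starm _ _ _)) (linear_tsum (star_assoc _ _ _ _)).
transitivity (\sw_(b1, b2 <- δ b) \sw_(d1, d' <- δ d) \sw_(d2, d3 <- δ d')
   \sw_(c2, c3 <- δ c') F b1 b2 c1 c2 c3 d1 d2 d3).
  rewrite tsum_exchange; apply: eq_tsum => b1 b2.
  transitivity (\sw_(c2, c3 <- δ c') \sw_(d1, d' <- δ d) \sw_(d2, d3 <- δ d')
     F b1 b2 c1 c2 c3 d1 d2 d3).
    apply: eq_tsum => c2 c3.
    by rewrite (tsum_comulA (F := fun d1 d2 d3 => F b1 b2 c1 c2 c3 d1 d2 d3)) //;
      move=> *; rewrite /F; lin.
  by rewrite tsum_exchange; apply: eq_tsum => d1 d'; rewrite tsum_exchange.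
rewrite tsum_exchange; apply: eq_tsum => d1 d'.
rewrite (linZ (starm _ _ _)) (linZ (star_assoc _ _ _ _)).
rewrite starmE skew_braidE lin_idmE mk_tsuml (linear_tsum (star_assoc _ _ _ _)) scale_tsumr.
apply: eq_tsum => b1 b2; rewrite mk_tsuml (linear_tsum (star_assoc _ _ _ _)) scale_tsumr.
apply: eq_tsum => d2 d3; rewrite mkZl (linZ (star_assoc _ _ _ _)) star_assocE !scale_tsumr.
by apply: eq_tsum => c2 c3; rewrite scalerA.
Qed.

(** The two sides multiply b by the two sides of [cbr_comm] for c and d. *)
Lemma skew_braid_B4 X A C D t :
  starm B (lin_idm X) (skew_braid A C D) (star_assoc B X (star B A C) D
    (starm B (star_assoc B X A C) (lin_idm D) t)) =
  star_assoc B X (star B A D) C (starm B (star_assoc B X A D) (lin_idm C)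
    (skew_braid (star B X A) C D t)).
Proof.
tens_elim t u v; tens_elim v d z; tens_elim u w q; tens_elim q c y.
tens_elim w x p; tens_elim p b a.
rewrite starmE star_assocE skew_braidE lin_idmE mk_tsuml.
rewrite (linear_tsum (star_assoc _ X (star B A C) D)) (linear_tsum (starm _ _ _)).
rewrite (linear_tsum (starm _ _ _)) (linear_tsum (star_assoc _ X (star B A D) C)).
pose V (e c d : B) := x ⊗ₜ ((b · e) ⊗ₜ ((a ⊗ₜ (d ⊗ₜ z)) ⊗ₜ (c ⊗ₜ y))).
have lV c3 d3 : linear (fun e => V e c3 d3) by rewrite /V; lin.
pose F (c1 c2 c3 d1 d2 d3 : B) := σ (c2 ⊗ₜ d2) *: V (c1 · d1) c3 d3.
pose G (c1 c2 c3 d1 d2 d3 : B) := σ (c1 ⊗ₜ d1) *: V (d2 · c2) c3 d3.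
(* The coaction of the regular comodule is δ, so this is coassociativity of δ in two variables. *)
have comulA2 := @tsum_coactA2 _ _ (regular_comodule B) (regular_comodule B).
transitivity (\sw_(c1, c' <- δ c) \sw_(d1, d' <- δ d) \sw_(c2, c3 <- δ c')
   \sw_(d2, d3 <- δ d') F c1 c2 c3 d1 d2 d3).
  apply: eq_tsum => c1 c'; rewrite star_assocE (linear_tsum (starm _ _ _)).
  apply: eq_tsum => d1 d'; rewrite starmE skew_braidE lin_idmE !mk_tsumr.
  apply: eq_tsum => c2 c3; rewrite !mk_tsumr; apply: eq_tsum => d2 d3.
  by rewrite !mkZr -bmulA.
transitivity (\sw_(c1, c' <- δ c) \sw_(d1, d' <- δ d) \sw_(c2, c3 <- δ c')
   \sw_(d2, d3 <- δ d') G c1 c2 c3 d1 d2 d3); last first.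
  apply: eq_tsum => c1 c'.
  rewrite (linear_tsum (starm _ _ _)) (linear_tsum (star_assoc _ X (star B A D) C)).
  apply: eq_tsum => d1 d'.
  rewrite (linZ (starm _ _ _)) (linZ (star_assoc _ X (star B A D) C)).
  rewrite starmE star_assocE lin_idmE mk_tsuml.
  rewrite (linear_tsum (star_assoc _ X (star B A D) C)) tsum_exchange scale_tsumr.
  apply: eq_tsum => d2 d3; rewrite star_assocE scale_tsumr.
  by apply: eq_tsum => c2 c3; rewrite -bmulA.
rewrite [LHS](comulA2 _ F); [|by move=> *; rewrite /F /V; lin..].
rewrite [RHS](comulA2 _ G); [|by move=> *; rewrite /G /V; lin..].
apply: eq_tsum => c' c3; apply: eq_tsum => d' d3.
have /esym E := congr1 (fun e => V e c3 d3) (cbr_comm σ c' d').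
rewrite !(tsum_out _ _ (lV c3 d3)) in E; apply: etrans (etrans E _).
  apply: eq_tsum => c1 c2; rewrite (tsum_out _ _ (lV c3 d3)); apply: eq_tsum => d1 d2.
  by rewrite (linear_funZ (lV c3 d3)).
apply: eq_tsum => c1 c2; rewrite (tsum_out _ _ (lV c3 d3)); apply: eq_tsum => d1 d2.
by rewrite (linear_funZ (lV c3 d3)).
Qed.

Lemma skew_braid_iso X A C : @is_iso (RModB B) _ _ (skew_braid X A C).
Proof.
have [g fK gK] := skew_braid_bij X A C.
by exists g; split; apply: linear_ext.
Qed.

Definition skew_braiding_of_cobraiding : skew_braiding (RModB B).
Proof.
refine (@SkewBraiding (RModB B) skew_braid _ skew_braid_iso _ _ _ _).
- move=> X X' A A' C C' f g h; apply: linear_ext; exact: (skew_braid_nat f g h).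
- move=> X A C D; unfold_RModB; apply: lin_comp33_ext; exact: skew_braid_B1.
- move=> X A C D; unfold_RModB; apply: lin_comp23_ext; exact: skew_braid_B2.
- move=> X A C D; unfold_RModB; apply: lin_comp23_ext; exact: skew_braid_B3.
- move=> X A C D; unfold_RModB; apply: lin_comp33_ext; exact: skew_braid_B4.
Defined.

End CobraidingToSkew.

(** * The identification of B ⊗ B with (R ⋆ R) ⋆ R *)

Section Pack.
Variables (R : comPzRingType) (B : bialgebra R).
Let I : lmodType R := R^o.
Let e : I := 1.

Lemma pack_linear :
  linear (fun t : B ⊗ B => \sw_(b, c <- t) (e ⊗ₜ (b ⊗ₜ e)) ⊗ₜ (c ⊗ₜ e)).
Proof. by lin. Qed.

Definition pack : {linear B ⊗ B -> star B (star B I I) I} := mk_linear pack_linear.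

Lemma packE b c : pack (b ⊗ₜ c) = (e ⊗ₜ (b ⊗ₜ e)) ⊗ₜ (c ⊗ₜ e).
Proof. by rewrite /pack mk_linearE tsumE //; lin. Qed.

Definition unpack : {linear star B (star B I I) I -> B ⊗ B} :=
  tmap (lin_compm (trunit B) (tlunit (B ⊗ I))) (trunit B).

Lemma unpackE k b l c m :
  unpack ((k ⊗ₜ (b ⊗ₜ l)) ⊗ₜ (c ⊗ₜ m)) = (k : R) *: ((l : R) *: ((m : R) *: (b ⊗ₜ c))).
Proof.
rewrite /unpack tmapE lin_compmE tlunitE (linZ (trunit B)) !trunitE.
by rewrite !mkZl mkZr.
Qed.

Lemma unpack1 b c : unpack ((e ⊗ₜ (b ⊗ₜ e)) ⊗ₜ (c ⊗ₜ e)) = b ⊗ₜ c.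
Proof. by rewrite unpackE !scale1r. Qed.

Lemma packK : cancel pack unpack.
Proof. by move=> t; tens_elim t b c; rewrite packE unpack1. Qed.

Lemma unpackK : cancel unpack pack.
Proof.
have scale_e (k : I) : k = (k : R) *: e by rewrite /e regular_scale1.
move=> t; tens_elim t u q; tens_elim u k p; tens_elim p b l; tens_elim q c m.
rewrite unpackE !(linZ pack) packE [in RHS](scale_e k) [in RHS](scale_e l) [in RHS](scale_e m).
by rewrite !(mkZl, mkZr) !scalerA mulrAC.
Qed.

Lemma scale_point_linear (X : lmodType R) (x : X) : linear (fun k : R^o => (k : R) *: x).
Proof. by lin. Qed.

Definition scale_point (X : lmodType R) (x : X) : {linear I -> X} :=
  mk_linear (scale_point_linear x).

Lemma scale_pointE (X : lmodType R) (x : X) : scale_point x e = x.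
Proof. exact: scale1r. Qed.

End Pack.

(** * From skew braidings to cobraidings *)

Section SkewToCobraiding.
Variables (R : comPzRingType) (B : bialgebra R) (s : skew_braiding (RModB B)).
Let I : lmodType R := R^o.
Let e : I := 1.
Implicit Types X A C D : lmodType R.

Definition sbr_lin X A C : {linear star B (star B X A) C -> star B (star B X C) A} :=
  s X A C.

Lemma sbr_lin_nat X X' A A' C C' (f : {linear X -> X'}) (g : {linear A -> A'})
    (h : {linear C -> C'}) t :
  sbr_lin X' A' C' (starm B (starm B f g) h t) =
  starm B (starm B f h) g (sbr_lin X A C t).
Proof.
exact: (congr1 (fun k : {linear star B (star B X A) C -> star B (star B X' C') A'} => k t)
  (sbr_nat s f g h)).
Qed.

Definition sbr_core : {linear B ⊗ B -> B ⊗ B} :=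
  lin_compm (unpack B) (lin_compm (sbr_lin I I I) (pack B)).

Notation S := sbr_core.

Lemma sbr_coreE t : S t = unpack B (sbr_lin I I I (pack B t)).
Proof. by []. Qed.

Lemma sbr_pack t : sbr_lin I I I (pack B t) = pack B (S t).
Proof. by rewrite sbr_coreE unpackK. Qed.

Lemma sbr_linE X A C x b a c y :
  sbr_lin X A C ((x ⊗ₜ (b ⊗ₜ a)) ⊗ₜ (c ⊗ₜ y)) =
  \sw_(p, q <- S (b ⊗ₜ c)) (x ⊗ₜ (p ⊗ₜ y)) ⊗ₜ (q ⊗ₜ a).
Proof.
have -> : (x ⊗ₜ (b ⊗ₜ a)) ⊗ₜ (c ⊗ₜ y) =
    starm B (starm B (scale_point x) (scale_point a)) (scale_point y) (pack B (b ⊗ₜ c)).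
  by rewrite packE !starmE !scale_pointE.
rewrite sbr_lin_nat sbr_pack; move: (S _) => t; tens_elim t p q.
by rewrite packE !starmE !scale_pointE tsumE //; lin.
Qed.

Lemma sbr_core_bij : exists2 T : {linear B ⊗ B -> B ⊗ B}, cancel T S & cancel S T.
Proof.
have [g [gK Kg]] := sbr_iso s I I I.
have gK' : cancel (sbr_lin I I I) g.
  move=> t; exact: (congr1 (fun k : {linear star B (star B I I) I ->
    star B (star B I I) I} => k t) gK).
have Kg' : cancel g (sbr_lin I I I).
  move=> t; exact: (congr1 (fun k : {linear star B (star B I I) I ->
    star B (star B I I) I} => k t) Kg).
exists (lin_compm (unpack B) (lin_compm g (pack B))) => t; rewrite /S !lin_compmE unpackK.
  by rewrite Kg' packK.
by rewrite gK' packK.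
Qed.

Lemma sbr_lin_B2 X A C D t :
  sbr_lin X A (star B C D) (star_assoc B (star B X A) C D t) =
  starm B (star_assoc B X C D) (lin_idm A) (sbr_lin (star B X C) A D
    (starm B (sbr_lin X A C) (lin_idm D) t)).
Proof.
exact: (congr1 (fun k : {linear star B (star B (star B X A) C) D ->
  star B (star B X (star B C D)) A} => k t) (sbr_B2 s X A C D)).
Qed.

Lemma sbr_lin_B3 X A C D t :
  sbr_lin X (star B A C) D (starm B (star_assoc B X A C) (lin_idm D) t) =
  star_assoc B (star B X D) A C (starm B (sbr_lin X A D) (lin_idm C)
    (sbr_lin (star B X A) C D t)).
Proof.
exact: (congr1 (fun k : {linear star B (star B (star B X A) C) D ->
  star B (star B X D) (star B A C)} => k t) (sbr_B3 s X A C D)).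
Qed.

Lemma sbr_lin_B4 X A C D t :
  starm B (lin_idm X) (sbr_lin A C D) (star_assoc B X (star B A C) D
    (starm B (star_assoc B X A C) (lin_idm D) t)) =
  star_assoc B X (star B A D) C (starm B (star_assoc B X A D) (lin_idm C)
    (sbr_lin (star B X A) C D t)).
Proof.
exact: (congr1 (fun k : {linear star B (star B (star B X A) C) D ->
  star B X (star B (star B A D) C)} => k t) (sbr_B4 s X A C D)).
Qed.

Let tst b c d : star B (star B (star B I I) I) I :=
  ((e ⊗ₜ (b ⊗ₜ e)) ⊗ₜ (c ⊗ₜ e)) ⊗ₜ (d ⊗ₜ e).

(** Axiom (B2) with all objects equal to R. The unit entries [e] are kept so that unit maps can
    still apply ε to a chosen leg. *)
Lemma core_B2 b c d :
  \sw_(d1, d2 <- δ d) \sw_(p, q <- S (b ⊗ₜ (c · d1)))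
    (e ⊗ₜ (p ⊗ₜ (e ⊗ₜ (d2 ⊗ₜ e)))) ⊗ₜ (q ⊗ₜ e) =
  \sw_(p, q <- S (b ⊗ₜ c)) \sw_(r, t <- S (q ⊗ₜ d)) \sw_(r1, r2 <- δ r)
    (e ⊗ₜ ((p · r1) ⊗ₜ (e ⊗ₜ (r2 ⊗ₜ e)))) ⊗ₜ (t ⊗ₜ e).
Proof.
have := sbr_lin_B2 (tst b c d); rewrite /tst starmE star_assocE sbr_linE lin_idmE.
rewrite mk_tsuml (linear_tsum (sbr_lin _ _ (star B I I))).
rewrite (linear_tsum (sbr_lin _ _ _)) (linear_tsum (starm _ _ _)) => E.
apply: etrans (etrans E _).
  by apply: eq_tsum => d1 d2; rewrite sbr_linE.
apply: eq_tsum => p q; rewrite sbr_linE (linear_tsum (starm _ _ _)).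
by apply: eq_tsum => r t; rewrite starmE star_assocE mk_tsuml.
Qed.

Lemma core_B3 b c d :
  \sw_(c1, c2 <- δ c) \sw_(p, q <- S ((b · c1) ⊗ₜ d))
    (e ⊗ₜ (p ⊗ₜ e)) ⊗ₜ (q ⊗ₜ (e ⊗ₜ (c2 ⊗ₜ e))) =
  \sw_(p, q <- S (c ⊗ₜ d)) \sw_(r, t <- S (b ⊗ₜ p)) \sw_(q1, q2 <- δ q)
    (e ⊗ₜ (r ⊗ₜ e)) ⊗ₜ ((t · q1) ⊗ₜ (e ⊗ₜ (q2 ⊗ₜ e))).
Proof.
have := sbr_lin_B3 (tst b c d); rewrite /tst starmE star_assocE sbr_linE lin_idmE.
rewrite mk_tsuml (linear_tsum (sbr_lin _ (star B I I) _)).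
rewrite (linear_tsum (starm _ _ _)) (linear_tsum (star_assoc _ _ _ _)) => E.
apply: etrans (etrans E _).
  by apply: eq_tsum => d1 d2; rewrite sbr_linE.
apply: eq_tsum => p q; rewrite starmE sbr_linE mk_tsuml (linear_tsum (star_assoc _ _ _ _)).
by apply: eq_tsum => r t; rewrite star_assocE.
Qed.

Lemma core_B4 b c d :
  \sw_(c1, c2 <- δ c) \sw_(d1, d2 <- δ d) \sw_(p, q <- S (c2 ⊗ₜ d2))
    e ⊗ₜ ((b · c1 · d1) ⊗ₜ ((e ⊗ₜ (p ⊗ₜ e)) ⊗ₜ (q ⊗ₜ e))) =
  \sw_(p, q <- S (c ⊗ₜ d)) \sw_(p1, p2 <- δ p) \sw_(q1, q2 <- δ q)
    e ⊗ₜ ((b · p1 · q1) ⊗ₜ ((e ⊗ₜ (p2 ⊗ₜ e)) ⊗ₜ (q2 ⊗ₜ e))).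
Proof.
have := sbr_lin_B4 (tst b c d); rewrite /tst starmE star_assocE sbr_linE lin_idmE.
rewrite mk_tsuml (linear_tsum (star_assoc _ _ (star B I I) _)).
rewrite (linear_tsum (starm _ _ _)) (linear_tsum (starm _ _ _)).
rewrite (linear_tsum (star_assoc _ _ _ _)) => E.
apply: etrans (etrans E _).
  apply: eq_tsum => c1 c2; rewrite star_assocE (linear_tsum (starm _ _ _)).
  by apply: eq_tsum => d1 d2; rewrite starmE sbr_linE !mk_tsumr.
apply: eq_tsum => p q; rewrite starmE star_assocE mk_tsuml (linear_tsum (star_assoc _ _ _ _)).
by apply: eq_tsum => r t; rewrite star_assocE.
Qed.

(** In [core_B2], φ applies ε to the second leg of δ, which the counit law then removes. *)
Lemma core_mulr b c d :
  S (b ⊗ₜ (c · d)) =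
  \sw_(p, q <- S (b ⊗ₜ c)) \sw_(r, t <- S (q ⊗ₜ d)) (p · r) ⊗ₜ t.
Proof.
pose φ := lin_compm (unpack B) (starm B (starm B (lin_idm I) (star_lunit B I)) (lin_idm I)).
have φE p q r : φ ((e ⊗ₜ (p ⊗ₜ (e ⊗ₜ (q ⊗ₜ e)))) ⊗ₜ (r ⊗ₜ e)) = ε q *: (p ⊗ₜ r).
  rewrite /φ lin_compmE !starmE star_lunitE scale1r !(mkZl, mkZr) (linZ (unpack B)).
  by rewrite unpack1.
have := congr1 φ (core_B2 b c d); rewrite !(linear_tsum φ) => E.
apply: etrans (etrans E _).
  rewrite -(tsum_counitr (g := fun d => S (b ⊗ₜ (c · d)))); last by lin.
  apply: eq_tsum => d1 d2; rewrite (linear_tsum φ) -[S _ in LHS]tsum_mk scale_tsumr.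
  by apply: eq_tsum => p q; rewrite φE.
apply: eq_tsum => p q; rewrite (linear_tsum φ); apply: eq_tsum => r t.
rewrite (linear_tsum φ) -(tsum_counitr (g := fun r => (p · r) ⊗ₜ t)); last by lin.
by apply: eq_tsum => r1 r2; rewrite φE.
Qed.

(** Here φ applies ε to the leading leg of [core_B2] instead, so the leg split off by the associator
    survives. *)
Lemma core_colinear_r b c d :
  \sw_(d1, d2 <- δ d) d2 ⊗ₜ cofree_counit B B (S (b ⊗ₜ (c · d1))) =
  \sw_(p, q <- S (b ⊗ₜ c)) ε p *: S (q ⊗ₜ d).
Proof.
pose φ := lin_compm (unpack B) (starm B (star_lunit B (star B I I)) (lin_idm I)).
have φE p q r : φ ((e ⊗ₜ (p ⊗ₜ (e ⊗ₜ (q ⊗ₜ e)))) ⊗ₜ (r ⊗ₜ e)) = ε p *: (q ⊗ₜ r).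
  rewrite /φ lin_compmE starmE star_lunitE scale1r mkZl (linZ (unpack B)).
  by rewrite unpack1.
have := congr1 φ (core_B2 b c d); rewrite !(linear_tsum φ) => E.
apply: etrans (etrans E _).
  apply: eq_tsum => d1 d2; rewrite (linear_tsum φ) -[S _ in LHS]tsum_mk linear_tsum mk_tsumr.
  by apply: eq_tsum => p q; rewrite φE cofree_counitE mkZr.
apply: eq_tsum => p q; rewrite (linear_tsum φ) -[S _ in RHS]tsum_mk scale_tsumr.
apply: eq_tsum => r t.
rewrite (linear_tsum φ) -(tsum_counitl (g := fun r => ε p *: (r ⊗ₜ t))); last by lin.
by apply: eq_tsum => r1 r2; rewrite φE bcounitM mulrC scalerA.
Qed.

Lemma core_mull b c d :
  S ((b · c) ⊗ₜ d) =
  \sw_(p, q <- S (c ⊗ₜ d)) \sw_(r, t <- S (b ⊗ₜ p)) r ⊗ₜ (t · q).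
Proof.
pose φ := lin_compm (unpack B) (starm B (lin_idm (star B I I)) (star_lunit B I)).
have φE p q r : φ ((e ⊗ₜ (p ⊗ₜ e)) ⊗ₜ (q ⊗ₜ (e ⊗ₜ (r ⊗ₜ e)))) = ε r *: (p ⊗ₜ q).
  rewrite /φ lin_compmE !starmE star_lunitE scale1r !mkZr (linZ (unpack B)).
  by rewrite unpack1.
have := congr1 φ (core_B3 b c d); rewrite !(linear_tsum φ) => E.
apply: etrans (etrans E _).
  rewrite -(tsum_counitr (g := fun c => S ((b · c) ⊗ₜ d))); last by lin.
  apply: eq_tsum => c1 c2; rewrite (linear_tsum φ) -[S _ in LHS]tsum_mk scale_tsumr.
  by apply: eq_tsum => p q; rewrite φE.
apply: eq_tsum => p q; rewrite (linear_tsum φ); apply: eq_tsum => r t.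
rewrite (linear_tsum φ) -(tsum_counitr (g := fun q => r ⊗ₜ (t · q))); last by lin.
by apply: eq_tsum => q1 q2; rewrite φE.
Qed.

Definition counit_r : {linear B ⊗ B -> B} := lin_compm (cofree_counit B B) (tflip B B).

Lemma counit_rE b c : counit_r (b ⊗ₜ c) = ε c *: b.
Proof. by rewrite /counit_r lin_compmE tflipE cofree_counitE. Qed.

(** The counterpart for [core_B3]: φ applies ε to the leg joining the two halves and drops the unit
    entry after it, which leaves an element of (R ⋆ R) ⋆ R. *)
Lemma core_colinear_l b c d :
  \sw_(c1, c2 <- δ c) counit_r (S ((b · c1) ⊗ₜ d)) ⊗ₜ c2 =
  \sw_(p, q <- S (c ⊗ₜ d)) counit_r (S (b ⊗ₜ p)) ⊗ₜ q.
Proof.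
pose φ := lin_compm (unpack B)
  (tmap (lin_idm (star B I I)) (lin_compm (tlunit (B ⊗ I)) (cofree_counit B (star B I I)))).
have φE p q r : φ ((e ⊗ₜ (p ⊗ₜ e)) ⊗ₜ (q ⊗ₜ (e ⊗ₜ (r ⊗ₜ e)))) = ε q *: (p ⊗ₜ r).
  rewrite /φ lin_compmE tmapE lin_compmE cofree_counitE (linZ (tlunit _)) tlunitE.
  by rewrite scale1r mkZr (linZ (unpack B)) unpack1.
have := congr1 φ (core_B3 b c d); rewrite !(linear_tsum φ) => E.
apply: etrans (etrans E _).
  apply: eq_tsum => c1 c2; rewrite (linear_tsum φ) -[S _ in LHS]tsum_mk linear_tsum mk_tsuml.
  by apply: eq_tsum => p q; rewrite φE counit_rE mkZl.
apply: eq_tsum => p q; rewrite (linear_tsum φ) -[S _ in RHS]tsum_mk linear_tsum mk_tsuml.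
apply: eq_tsum => r t; rewrite counit_rE mkZl.
rewrite (linear_tsum φ) -(tsum_counitl (g := fun q => ε t *: (r ⊗ₜ q))); last by lin.
by apply: eq_tsum => q1 q2; rewrite φE bcounitM mulrC scalerA.
Qed.

Let one : B := bunit B 1.

(* Multiplying by 1 in [core_mulr] gives φ ∘ S = S for φ as below, and S is onto. *)
Lemma core_unitr b : S (b ⊗ₜ one) = one ⊗ₜ b.
Proof.
have lφ : linear (fun u => \sw_(p, q <- u) \sw_(r, t <- S (q ⊗ₜ one)) (p · r) ⊗ₜ t) by lin.
pose φ := mk_linear lφ.
have φE p q : φ (p ⊗ₜ q) = \sw_(r, t <- S (q ⊗ₜ one)) (p · r) ⊗ₜ t.
  by rewrite [LHS]mk_linearE tsumE //; lin.
have φS u : φ (S u) = S u.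
  by tens_elim u c d; rewrite [LHS]mk_linearE -core_mulr bmulb1.
have [T TK _] := sbr_core_bij.
have <- : φ (one ⊗ₜ b) = one ⊗ₜ b by rewrite -(TK (one ⊗ₜ b)) φS.
rewrite φE -[LHS]tsum_mk.
by apply: eq_tsum => r t; rewrite bmul1b.
Qed.

(** By [core_mull] with first factor 1, the map φ below fixes the image of S, which is
    everything. *)
Lemma core_unitl d : S (one ⊗ₜ d) = d ⊗ₜ one.
Proof.
have lφ : linear (fun u => \sw_(p, q <- u) \sw_(r, t <- S (one ⊗ₜ p)) r ⊗ₜ (t · q)) by lin.
pose φ := mk_linear lφ.
have φE p q : φ (p ⊗ₜ q) = \sw_(r, t <- S (one ⊗ₜ p)) r ⊗ₜ (t · q).
  by rewrite [LHS]mk_linearE tsumE //; lin.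
have φS u : φ (S u) = S u.
  by tens_elim u b c; rewrite [LHS]mk_linearE -core_mull bmul1b.
have [T TK _] := sbr_core_bij.
have <- : φ (d ⊗ₜ one) = d ⊗ₜ one by rewrite -(TK (d ⊗ₜ one)) φS.
rewrite φE -[LHS]tsum_mk.
by apply: eq_tsum => r t; rewrite bmulb1.
Qed.

Definition core_form : {scalar B ⊗ B} := mk_scalar (lin_form (counit2 B) (linearP S)).

Lemma core_formE t : core_form t = counit2 B (S t).
Proof. by []. Qed.

(** Take c = 1 in [core_colinear_r]; the value S(b ⊗ 1) = 1 ⊗ b reduces the other side to S(b ⊗
    d). *)
Lemma core_splitr b d :
  S (b ⊗ₜ d) = \sw_(d1, d2 <- δ d) d2 ⊗ₜ cofree_counit B B (S (b ⊗ₜ d1)).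
Proof.
have E := core_colinear_r b one d; rewrite core_unitr tsumE in E; last by lin.
rewrite bcounit1 scale1r in E; rewrite -E.
by apply: eq_tsum => d1 d2; rewrite bmul1b.
Qed.

Lemma core_splitl c d :
  S (c ⊗ₜ d) = \sw_(c1, c2 <- δ c) counit_r (S (c1 ⊗ₜ d)) ⊗ₜ c2.
Proof.
rewrite -[LHS]tsum_mk; transitivity (\sw_(p, q <- S (c ⊗ₜ d)) counit_r (S (one ⊗ₜ p)) ⊗ₜ q).
  by apply: eq_tsum => p q; rewrite core_unitl counit_rE bcounit1 scale1r.
by rewrite -core_colinear_l; apply: eq_tsum => c1 c2; rewrite bmul1b.
Qed.

Lemma counit_counit_r t : ε (counit_r t) = counit2 B t.
Proof.
have E : mk_scalar (lin_form (bcounit B) (linearP counit_r)) = counit2 B.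
  by apply: scalar_tens_ext => b c; rewrite [LHS]mk_scalarE counit_rE scalarZE counit2E mulrC.
exact: (congr1 (fun f : {scalar B ⊗ B} => f t) E).
Qed.

(** Splitting off a leg of c and then a leg of b leaves ε ⊗ ε of S on the first legs, which is the
    form. *)
Lemma coreE b c : S (b ⊗ₜ c) =
  \sw_(b1, b2 <- δ b) \sw_(c1, c2 <- δ c) core_form (b1 ⊗ₜ c1) *: (c2 ⊗ₜ b2).
Proof.
rewrite core_splitr tsum_exchange; apply: eq_tsum => c1 c2.
rewrite core_splitl linear_tsum mk_tsumr; apply: eq_tsum => b1 b2.
by rewrite cofree_counitE counit_counit_r mkZr.
Qed.

Lemma core_form_invertible : convolution_invertible core_form.
Proof. by have [T TK KT] := sbr_core_bij; apply: (convolution_invertible_bij coreE TK KT). Qed.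

Lemma core_form_mulr a b c :
  core_form (a ⊗ₜ (b · c)) =
  \sw_(a1, a2 <- δ a) (core_form (a1 ⊗ₜ b) * core_form (a2 ⊗ₜ c) : R^o).
Proof.
rewrite core_formE core_mulr (tsum_colinear coreE
  (F := fun p q => \sw_(r, t <- S (q ⊗ₜ c)) (p · r) ⊗ₜ t)); last by lin.
rewrite scalar_tsum; apply: eq_tsum_form => a1 a2.
rewrite scalar_tsum -[in RHS](bcounitr b) mk_tsumr scalar_tsum mul_tsuml.
apply: eq_tsum_form => b1 b2; rewrite mkZr !scalarZE.
have -> : counit2 B (\sw_(r, t <- S (a2 ⊗ₜ c)) (b2 · r) ⊗ₜ t) = ε b2 * core_form (a2 ⊗ₜ c).
  rewrite core_formE -[S _ in RHS]tsum_mk !scalar_tsum [RHS]mulrC mul_tsuml.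
  by apply: eq_tsum_form => r t; rewrite !counit2E bcounitM [RHS]mulrC mulrA.
by rewrite mulrCA mulrA.
Qed.

Lemma core_form_mull a b c :
  core_form ((a · b) ⊗ₜ c) =
  \sw_(c1, c2 <- δ c) (core_form (a ⊗ₜ c2) * core_form (b ⊗ₜ c1) : R^o).
Proof.
rewrite core_formE core_mull (tsum_colinear coreE
  (F := fun p q => \sw_(r, t <- S (a ⊗ₜ p)) r ⊗ₜ (t · q))); last by lin.
rewrite tsum_exchange scalar_tsum; apply: eq_tsum_form => c1 c2.
rewrite scalar_tsum mulrC -[in RHS](bcounitr b) mk_tsuml scalar_tsum mul_tsuml.
apply: eq_tsum_form => b1 b2; rewrite mkZl !scalarZE.
have -> : counit2 B (\sw_(r, t <- S (a ⊗ₜ c2)) r ⊗ₜ (t · b2)) = core_form (a ⊗ₜ c2) * ε b2.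
  rewrite core_formE -[S _ in RHS]tsum_mk !scalar_tsum mul_tsuml.
  by apply: eq_tsum_form => r t; rewrite !counit2E bcounitM mulrA.
by rewrite mulrA mulrC mulrA.
Qed.

(** Take b = 1 in [core_B4] and apply ε to the last two copies of B. One side becomes the product of
    the factors of S(a ⊗ b), which [coreE] expands. *)
Lemma core_form_comm a b :
  \sw_(a1, a2 <- δ a) \sw_(b1, b2 <- δ b) core_form (a1 ⊗ₜ b1) *: (b2 · a2) =
  \sw_(a1, a2 <- δ a) \sw_(b1, b2 <- δ b) core_form (a2 ⊗ₜ b2) *: (a1 · b1).
Proof.
pose φ := lin_compm (trunit B) (lin_compm (tlunit (B ⊗ I))
  (starm B (lin_idm I) (lin_compm (star_lunit B I) (starm B (star_lunit B I) (lin_idm I))))).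
have φE g p q : φ (e ⊗ₜ (g ⊗ₜ ((e ⊗ₜ (p ⊗ₜ e)) ⊗ₜ (q ⊗ₜ e)))) = (ε p * ε q) *: g.
  rewrite /φ !lin_compmE starmE lin_compmE starmE !star_lunitE tlunitE (linZ (trunit B)) trunitE !scale1r.
  (* Scaling in [R^o] is multiplication, so the nested unit maps return the product of ε p * 1 and ε
     q * 1. *)
  by congr (_ *: _); rewrite -[LHS]/((ε p * 1) * (ε q * 1)) !mulr1.
have := congr1 φ (core_B4 one a b); rewrite !(linear_tsum φ) => /esym E.
apply: etrans (etrans E _).
  transitivity (\sw_(p, q <- S (a ⊗ₜ b)) p · q).
    by rewrite (tsum_colinear coreE (F := fun p q => p · q)) //; lin.
  apply: eq_tsum => p q; rewrite (linear_tsum φ).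
  rewrite -[in LHS](bcounitr p) mk_tsuml linear_tsum; apply: eq_tsum => p1 p2.
  rewrite (linear_tsum φ) -[in LHS](bcounitr q) mk_tsumr linear_tsum.
  apply: eq_tsum => q1 q2; rewrite φE bmul1b mkZl mkZr.
  by rewrite !(linZ (bmul B)) scalerA.
apply: eq_tsum => a1 a2; rewrite (linear_tsum φ); apply: eq_tsum => b1 b2.
rewrite (linear_tsum φ) core_formE -[S _ in RHS]tsum_mk scalar_tsum scale_tsuml.
by apply: eq_tsum => p q; rewrite φE bmul1b counit2E.
Qed.

Definition sbr_cobraiding : cobraiding B :=
  Cobraiding core_form_invertible core_form_comm core_form_mull core_form_mulr.

End SkewToCobraiding.

(** * The bijection between cobraidings and skew braidings, and the conclusion *)

Section SkewBijection.
Variables (R : comPzRingType) (B : bialgebra R).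

Lemma skew_braiding_ext (s t : skew_braiding (RModB B)) :
  (forall X A C, sbr_lin s X A C =1 sbr_lin t X A C) -> s = t.
Proof.
case: s t => [s p1 p2 p3 p4 p5 p6] [t q1 q2 q3 q4 q5 q6] /= st.
have {}st : s = t.
  apply: functional_extensionality_dep => X; apply: functional_extensionality_dep => A.
  by apply: functional_extensionality_dep => C; apply: linear_ext (st X A C).
subst t; congr SkewBraiding; exact: Prop_irrelevance.
Qed.

Lemma sbr_cobraidingK : cancel (@sbr_cobraiding R B) (@skew_braiding_of_cobraiding R B).
Proof.
move=> s; apply: skew_braiding_ext => X A C t.
tens_elim t u v; tens_elim u x p; tens_elim p b a; tens_elim v c y.
rewrite [LHS]skew_braidE sbr_linE (tsum_colinear (coreE s)) //; lin.
Qed.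

Lemma skew_braiding_of_cobraidingK : cancel (@skew_braiding_of_cobraiding R B) (@sbr_cobraiding R B).
Proof.
move=> σ; apply: cobraiding_ext => b c.
apply: (counit2_colinear (S := sbr_core (skew_braiding_of_cobraiding σ))) => b0 c0.
rewrite sbr_coreE packE -[sbr_lin _ _ _ _]/(skew_braid σ R^o R^o R^o) skew_braidE.
rewrite linear_tsum; apply: eq_tsum => b1 b2; rewrite linear_tsum.
by apply: eq_tsum => c1 c2; rewrite linZ unpack1.
Qed.

End SkewBijection.

Theorem theorem4p7 (R : comPzRingType) (B : bialgebra R) :
  (exists f : cobraiding B -> skew_braiding (RModB B), bijective f) /\
  (exists g : cobraiding B -> braiding (ComodB B), bijective g) /\
  (exists h : skew_braiding (RModB B) -> braiding (ComodB B), bijective h).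
Proof.
have bij_f : bijective (@skew_braiding_of_cobraiding R B).
  exists (@sbr_cobraiding R B); [exact: skew_braiding_of_cobraidingK | exact: sbr_cobraidingK].
have bij_f' : bijective (@sbr_cobraiding R B).
  exists (@skew_braiding_of_cobraiding R B); [exact: sbr_cobraidingK | exact: skew_braiding_of_cobraidingK].
have bij_g : bijective (@comod_braiding R B).
  exists (@br_cobraiding R B); [exact: comod_braidingK | exact: br_cobraidingK].
split; first by exists (@skew_braiding_of_cobraiding R B).
split; first by exists (@comod_braiding R B).
by exists (@comod_braiding R B \o @sbr_cobraiding R B); apply: bij_comp.
Qed.
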